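(* Consider the problem \textsc{ConRMC}: given a finite alphabet $\Sigma$, an incomplete matrix $\mathbf{S} \in (\Sigma \cup \{*\})^{n \times \ell}$ and nonnegative integers $d_1, \dots, d_n$, decide whether there is a vector $v \in \Sigma^\ell$ such that $\delta(v, \mathbf{S}[i]) \le d_i$ for each $i \in [n]$. Let $d = \max_{i \in [n]} d_i$ and let $k$ be the maximum number of missing entries in any row of $\mathbf{S}$. Then \textsc{ConRMC} can be solved in $O(n\ell + 2^{4d+k} \cdot |\Sigma|^{d+k} \cdot n(d+k))$ time.
   Context: The symbol $*$ denotes a missing entry and is not in $\Sigma$. $\mathbf{S}[i]$ denotes the $i$-th row. For $v, v' \in (\Sigma \cup \{*\})^\ell$, $\delta(v,v')$ is the number of positions $j$ with $v[j] \ne v'[j]$, $v[j]\ne *$ and $v'[j]\ne *$. $[n]=\{1,\dots,n\}$. *)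

(* Defs.v *)
From mathcomp Require Import all_boot matrix.
Set Implicit Arguments.
Unset Strict Implicit.
Unset Printing Implicit Defensive.

(* Machine model: a word RAM, presented as a structured language.  The memory
   consists of registers (named by a fixed number occurring in the program) and
   of zero-initialised arrays (likewise named by a fixed number) supporting
   random access.  A program mentions finitely many names only, so interleaving
   its arrays turns it into ordinary RAM code with constant overhead. *)

Inductive expr : Type :=
| Const of nat
| Var of nat
| Get of nat & expr
| Add of expr & expr
| Sub of expr & expr
| Mul of expr & expr
| Eq of expr & expr
| Lt of expr & expr.

Inductive cmd : Type :=
| Skip
| Assign of nat & expr
| Store of nat & expr & expr
| Seq of cmd & cmd
| If of expr & cmd & cmd
| While of expr & cmd.

Record state : Type := State { var : nat -> nat; arr : nat -> nat -> nat }.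

Definition set_var (s : state) (x v : nat) : state :=
  State (fun y => if y == x then v else var s y) (arr s).

Definition set_arr (s : state) (a i v : nat) : state :=
  State (var s)
    (fun b j => if (b == a) && (j == i) then v else arr s b j).

Fixpoint eval (s : state) (e : expr) : nat :=
  match e with
  | Const m => m
  | Var x => var s x
  | Get a e1 => arr s a (eval s e1)
  | Add e1 e2 => eval s e1 + eval s e2
  | Sub e1 e2 => eval s e1 - eval s e2
  | Mul e1 e2 => eval s e1 * eval s e2
  | Eq e1 e2 => eval s e1 == eval s e2
  | Lt e1 e2 => eval s e1 < eval s e2
  end.

Fixpoint cost (e : expr) : nat :=
  match e with
  | Const _ | Var _ => 1
  | Get _ e1 => (cost e1).+1
  | Add e1 e2 | Sub e1 e2 | Mul e1 e2 | Eq e1 e2 | Lt e1 e2 =>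
      (cost e1 + cost e2).+1
  end.

(* [exec W c s t s']: from [s], the command [c] terminates in [s'] after exactly
   [t] unit-cost operations.  Only values below [W] can be written to memory: a
   larger one blocks the execution.  Since the expressions of a program have
   constant size, temporaries inside an expression then fit in O(log W) bits. *)
Inductive exec (W : nat) : cmd -> state -> nat -> state -> Prop :=
| exec_skip s : exec W Skip s 1 s
| exec_assign s x e :
    eval s e < W ->
    exec W (Assign x e) s (cost e).+1 (set_var s x (eval s e))
| exec_store s a e1 e2 :
    eval s e2 < W ->
    exec W (Store a e1 e2) s (cost e1 + cost e2).+1
      (set_arr s a (eval s e1) (eval s e2))
| exec_seq s1 s2 s3 c1 c2 t1 t2 :
    exec W c1 s1 t1 s2 -> exec W c2 s2 t2 s3 ->
    exec W (Seq c1 c2) s1 (t1 + t2) s3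
| exec_if_true s s' e c1 c2 t :
    eval s e != 0 -> exec W c1 s t s' ->
    exec W (If e c1 c2) s (cost e + t).+1 s'
| exec_if_false s s' e c1 c2 t :
    eval s e = 0 -> exec W c2 s t s' ->
    exec W (If e c1 c2) s (cost e + t).+1 s'
| exec_while_stop s e c :
    eval s e = 0 -> exec W (While e c) s (cost e).+1 s
| exec_while_step s1 s2 s3 e c t1 t2 :
    eval s1 e != 0 -> exec W c s1 t1 s2 -> exec W (While e c) s2 t2 s3 ->
    exec W (While e c) s1 (cost e + t1 + t2).+1 s3.

(* An entry of an incomplete matrix has type [option Sigma], the missing entry
   being [None]. *)
Section Problem.
Variable Sigma : finType.

Definition delta (l : nat) (u w : 'rV[option Sigma]_l) : nat :=
  #|[set j : 'I_l | [&& u ord0 j != w ord0 j, u ord0 j != None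
                      & w ord0 j != None]]|.

Variables (n l : nat) (S : 'M[option Sigma]_(n, l)) (d : 'I_n -> nat).

Definition ConRMC : Prop :=
  exists v : 'rV[Sigma]_l,
    forall i : 'I_n, delta (map_mx Some v) (row i S) <= d i.

Definition max_radius : nat := \max_(i < n) d i.

Definition max_missing : nat :=
  \max_(i < n) #|[set j : 'I_l | S i j == None]|.

Definition encode_entry (x : option Sigma) : nat :=
  if x is Some a then (enum_rank a).+1 else 0.

(* Input convention: registers 0, 1, 2 hold n, l and the alphabet size, array 0
   holds the radii and array 1 the matrix in row-major order; everything else
   is 0. *)
Definition input_state : state :=
  State (nth 0 [:: n; l; #|Sigma|])
    (fun a => nth 0 (nth [::]
       [:: [seq d i | i <- enum 'I_n];
           [seq encode_entry (S i j) | i <- enum 'I_n, j <- enum 'I_l]] a)).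

(* Magnitude of the numbers describing an instance; words of O(log
   input_magnitude) bits hold values below a fixed power of it. *)
Definition input_magnitude : nat := n + l + #|Sigma| + max_radius + 2.

End Problem.

Lemma input_state_radius (Sigma : finType) (n l : nat)
    (S : 'M[option Sigma]_(n, l)) (d : 'I_n -> nat) (i : 'I_n) :
  arr (input_state S d) 0 i = d i.
Proof. by rewrite /= (nth_map i) ?nth_ord_enum // size_enum_ord. Qed.

Lemma input_state_entry (Sigma : finType) (n l : nat)
    (S : 'M[option Sigma]_(n, l)) (d : 'I_n -> nat) (i : 'I_n) (j : 'I_l) :
  arr (input_state S d) 1 (i * l + j) = encode_entry (S i j).
Proof.
rewrite /=.
suff H (r : seq 'I_n) (m : nat) : m < size r ->
    nth 0 [seq encode_entry (S x y) | x <- r, y <- enum 'I_l] (m * l + j)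
    = encode_entry (S (nth i r m) j).
  by rewrite H ?size_enum_ord // nth_ord_enum.
elim: r m => [|x r IHr] [|m] //= Hm; rewrite nth_cat size_map size_enum_ord.
  by rewrite mul0n add0n ltn_ord (nth_map j) ?size_enum_ord // nth_ord_enum.
by rewrite mulSn -addnA ltnNge leq_addr /= addKn; exact: IHr.
Qed.

(* Main.v *)
(** Guess the missing entries of the first row ([|Sigma|^k] ways) to get a
    string [t] at distance at most [d] from a solution.  If [t] itself violates
    row [f], let [L] be the columns where row [f] is missing or differs from
      [t].
    Off [L] every change of [t] moves away from row [f], so a solution differs
    from [t] off [L] in fewer places than on [L].  After guessing the [w]
    changes on [L] (Ma and Sun's search for the closest string), the remaining
    budget drops from [b] to [min (b - w) (w - 1) < b / 2].  As
    [|L| <= d + b + k], the identity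
    [sum_w C(d+k+b, w) C(d+k+b-w, b-w) = C(d+k+b, b) 2^b] bounds the number of
    nodes by [C(d+k+b, b) 4^b |Sigma|^b].  Only the [O(n (d + k))] columns that
    are not constant are ever inspected, and the distances to all rows are
    updated in time [O(n)] per changed letter. *)
From Pilot Require (* Again, since [Sub] also names the subtype constructor of
  MathComp. *)
Import Defs.
From mathcomp Require Import all_boot matrix.
From mathcomp Require Import zify ring.
From Stdlib Require Import FunctionalExtensionality.
Import Defs.
Set Implicit Arguments.
Unset Strict Implicit.
Unset Printing Implicit Defensive.

(** The language has no procedures, so the recursion becomes one loop over a queue of columns with
    saved records, and a subsearch is a run of iterations of that loop instead of a subcommand. The
    loop halts at the first string that satisfies all rows. A subsearch that returns therefore has
    only to refute its own claim and to restore what its callers own. The bound on the columns needs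
    a preliminary test. Every solution lies within [d 0 + k0] of the initial string, [k0] being the
    number of missing entries of the first row, so a row [i] farther than [d i + d 0 + k0] from that
    string excludes solutions. If no row is that far, each row differs from the string in O(d + k)
    places. The node bound closes by induction because the next budget b' satisfies 2b' <= b - 1,
    hence 4^b' <= 2^(b-1). Together with the binomial identity, the subtrees then use only half of
    the bound for b, and the other half pays for the node itself. *)

Definition runs W c s (Q : nat -> state -> Prop) :=
  exists t s', exec W c s t s' /\ Q t s'.

(** * Total correctness with running time *)

Section Runs.
Variable W : nat.

Lemma runs_weaken c s (P Q : nat -> state -> Prop) :
  runs W c s P -> (forall t s', P t s' -> Q t s') -> runs W c s Q.
Proof. by move=> [t [s' [He HP]]] PQ; exists t, s'; split=> //; exact: PQ. Qed.

Lemma runs_skip s (Q : nat -> state -> Prop) : Q 1 s -> runs W Skip s Q.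
Proof. by move=> H; exists 1, s; split=> //; constructor. Qed.

Lemma runs_assign s x e (Q : nat -> state -> Prop) :
  eval s e < W -> Q (cost e).+1 (set_var s x (eval s e)) ->
  runs W (Assign x e) s Q.
Proof. by move=> He HQ; do 2 eexists; split; [apply: exec_assign|exact: HQ].
  Qed.

Lemma runs_store s a e1 e2 (Q : nat -> state -> Prop) :
  eval s e2 < W ->
  Q (cost e1 + cost e2).+1 (set_arr s a (eval s e1) (eval s e2)) ->
  runs W (Store a e1 e2) s Q.
Proof. by move=> He HQ; do 2 eexists; split; [apply: exec_store|exact: HQ]. Qed.

Lemma runs_seq s c1 c2 (Q : nat -> state -> Prop) :
  runs W c1 s (fun t1 s1 => runs W c2 s1 (fun t2 => Q (t1 + t2))) ->
  runs W (Seq c1 c2) s Q.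
Proof.
move=> [t1 [s1 [H1 [t2 [s2 [H2 HQ]]]]]].
by exists (t1 + t2), s2; split=> //; apply: exec_seq H1 H2.
Qed.

Lemma runs_if s e c1 c2 (Q : nat -> state -> Prop) :
  (eval s e != 0 -> runs W c1 s (fun t => Q (cost e + t).+1)) ->
  (eval s e = 0 -> runs W c2 s (fun t => Q (cost e + t).+1)) ->
  runs W (If e c1 c2) s Q.
Proof.
move=> H1 H2; case: (eqVneq (eval s e) 0) => [E|N].
  have [t [s' [Hx HQ]]] := H2 E.
  by do 2 eexists; split; [apply: exec_if_false Hx|exact: HQ].
have [t [s' [Hx HQ]]] := H1 N.
by do 2 eexists; split; [apply: exec_if_true Hx|exact: HQ].
Qed.

Lemma runs_for e c s N B (I : nat -> state -> Prop) :
  (forall i s1, i <= N -> I i s1 -> eval s1 e = (i < N)) ->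
  (forall i s1, i < N -> I i s1 ->
     runs W c s1 (fun t s2 => t <= B /\ I i.+1 s2)) ->
  I 0 s ->
  runs W (While e c) s
    (fun t s1 => t <= (cost e).+1 + N * ((cost e).+1 + B) /\ I N s1).
Proof.
move=> He Hc H0.
suff: forall k i s1, i + k = N -> I i s1 -> runs W (While e c) s1
    (fun t s2 => t <= (cost e).+1 + k * ((cost e).+1 + B) /\ I N s2).
  by move/(_ N 0 s (add0n N) H0).
elim=> [|k IHk] i s1 Hi HI.
  exists (cost e).+1, s1; split; last by split; [lia|have <- : i = N by lia].
  apply: exec_while_stop.
  by rewrite (He i) //; lia.
have [|t1 [s2 [H1 [T1 I1]]]] := Hc i s1 _ HI; first by lia.
have [|t2 [s3 [H2 [T2 I2]]]] := IHk i.+1 s2 _ I1; first by lia.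
exists (cost e + t1 + t2).+1, s3; split; last by split=> //; lia.
apply: exec_while_step H1 H2.
by rewrite (He i) //; lia.
Qed.

End Runs.

(** * Footprints of commands *)

Definition frame (xs ys : seq nat) (s s' : state) :=
  (forall x, x \notin xs -> var s' x = var s x) /\
  (forall y, y \notin ys -> arr s' y = arr s y).

Lemma frame_refl xs ys s : frame xs ys s s.
Proof. by split. Qed.

Lemma frame_set_var xs ys s s' x v :
  x \in xs -> frame xs ys s s' -> frame xs ys s (set_var s' x v).
Proof.
move=> Hx [F G]; split=> y Hy /=; last exact: G.
by case: eqP => [E|_]; [rewrite E Hx in Hy|exact: F].
Qed.

Lemma frame_set_arr xs ys s s' y i v :
  y \in ys -> frame xs ys s s' -> frame xs ys s (set_arr s' y i v).
Proof.
move=> Hy [F G]; split=> x Hx; [exact: F|rewrite -G //].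
apply: functional_extensionality => j /=.
by case: eqP => [E|_] //=; rewrite E Hy in Hx.
Qed.

Lemma frame_sub xs ys xs' ys' s s' :
  all (mem xs) xs' -> all (mem ys) ys' -> frame xs' ys' s s' -> frame xs ys s
    s'.
Proof.
move=> /allP Hx /allP Hy [F G].
by split=> x H; [apply: F; apply: contra H => /Hx|apply: G;
  apply: contra H => /Hy].
Qed.

Ltac fr := do ?[apply: frame_set_var => //|apply: frame_set_arr => //];
  try exact: frame_refl; try by split.

(** * The program *)

Definition upd (f : nat -> nat) (x v : nat) := fun y => if y == x then v else f
  y.

(** One position's share of [delta], with letters coded from 1 and a missing entry by 0. It vanishes
    at [a = 0] too, so the zero-initialised string and distances already agree before the first
    letter is written. *)
Definition mism (x a : nat) : nat := [&& 0 < x, 0 < a & x != a].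

Infix ";;" := Seq (at level 60, right associativity).
Definition ne x y := Eq (Eq x y) (Const 0).
Definition emism x a := Mul (Mul (Lt (Const 0) x) (Lt (Const 0) a)) (ne x a).
Definition entry i j := Get 1 (Add (Mul i (Var 1)) j).
Definition incr x := Assign x (Add (Var x) (Const 1)).

Lemma eval_ne s x y : eval s (ne x y) = (eval s x != eval s y).
Proof. by rewrite /=; case: (eval s x == eval s y). Qed.

Lemma eval_emism s x a : eval s (emism x a) = mism (eval s x) (eval s a).
Proof. rewrite /= /mism; by case: (0 < eval s x); case: (0 < eval s a);
  case: (eval s x == eval s a). Qed.

(* Registers: 0, 1, 2 the sizes; 3 and 4 the numbers of inspected columns and of
   missing entries of row 0; 5 and 6 the current and the end position in the
   queue of columns to decide; 7 the budget; 8 the number of changes since it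
     was
   set; 9 the mode (0 stop, 1 forward, 2 backward); 10 to 19 temporaries.
   Arrays: 2 the string [t]; 3 its distances to the rows; 4 the inspected
   columns; 5 the queue; 6 to 10 what backtracking restores at each queue
   position (old letter, last choice, registers 6, 7 and 8). *)
Definition set_cell :=
  Assign 17 (Get 2 (Var 11)) ;; Assign 13 (Const 0) ;; Assign 10 (Const 0) ;;
  While (Lt (Var 10) (Var 0))
    (Assign 16 (entry (Var 10) (Var 11)) ;;
     Store 3 (Var 10) (Sub (Add (Get 3 (Var 10)) (emism (Var 16) (Var 12)))
                           (emism (Var 16) (Var 17))) ;;
     Assign 13 (Add (Var 13) (ne (Var 16) (Var 12))) ;;
     incr 10) ;;
  Store 2 (Var 11) (Var 12).

(** Register 15 is a slack on the radii: zero in [solve], and [d 0 + k0] in the test before the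
    search. The value [n] in register 18 stands for no row. *)
Definition find :=
  Assign 18 (Var 0) ;; Assign 10 (Const 0) ;;
  While (Lt (Var 10) (Var 0))
    (If (Lt (Add (Get 0 (Var 10)) (Var 15)) (Get 3 (Var 10)))
        (Assign 18 (Var 10)) Skip ;;
     incr 10).

Definition scan :=
  Assign 14 (Const 0) ;;
  While (Lt (Var 14) (Var 3))
    (Assign 11 (Get 4 (Var 14)) ;;
     If (ne (entry (Var 18) (Var 11)) (Get 2 (Var 11)))
        (Store 5 (Var 6) (Var 11) ;; incr 6) Skip ;;
     incr 14).

Definition solve :=
  If (Lt (Sub (Var 7) (Var 8)) (Sub (Var 8) (Const 1)))
     (Assign 7 (Sub (Var 7) (Var 8))) (Assign 7 (Sub (Var 8) (Const 1))) ;;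
  Assign 8 (Const 0) ;; Assign 15 (Const 0) ;; find ;;
  If (Eq (Var 18) (Var 0)) (Assign 9 (Const 0))
    (If (Lt (Add (Get 0 (Var 18)) (Var 7)) (Get 3 (Var 18)))
        (Assign 9 (Const 2)) scan).

(* Choice 0 keeps the letter for free and choice [c > 0] writes [c]; the missing
   entries of row 0 come first in the queue and hold the letter 1, so they start
   from choice 1. *)
Definition descend :=
  Store 6 (Var 5) (Get 2 (Get 5 (Var 5))) ;;
  Store 7 (Var 5) (Lt (Var 5) (Var 4)) ;;
  Store 8 (Var 5) (Var 6) ;; Store 9 (Var 5) (Var 7) ;;
  Store 10 (Var 5) (Var 8) ;; incr 5.

Definition backtrack :=
  If (Var 5)
    (Assign 5 (Sub (Var 5) (Const 1)) ;;
     Assign 6 (Get 8 (Var 5)) ;; Assign 7 (Get 9 (Var 5)) ;;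
     Assign 8 (Get 10 (Var 5)) ;; Assign 11 (Get 5 (Var 5)) ;;
     If (Mul (Lt (Get 7 (Var 5)) (Var 2)) (Lt (Var 8) (Var 7)))
       (Assign 12 (Add (Get 7 (Var 5)) (Const 1)) ;;
        Store 7 (Var 5) (Var 12) ;;
        Assign 8 (Add (Var 8) (Lt (Var 4) (Add (Var 5) (Const 1)))) ;;
        set_cell ;; incr 5 ;; Assign 9 (Const 1))
       (Assign 12 (Get 6 (Var 5)) ;; set_cell))
    (Assign 0 (Const 0) ;; Assign 9 (Const 0)).

Definition search_step :=
  If (Eq (Var 9) (Const 1)) (If (Eq (Var 5) (Var 6)) solve descend) backtrack.

Definition search := While (Var 9) search_step.

Definition initialise :=
  While (Lt (Var 19) (Var 1))
    (Assign 11 (Var 19) ;; Assign 12 (entry (Const 0) (Var 11)) ;;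
     If (Var 12) Skip
       (Assign 12 (Const 1) ;; Store 5 (Var 4) (Var 11) ;; incr 4) ;;
     set_cell ;;
     If (Var 13) (Store 4 (Var 3) (Var 11) ;; incr 3) Skip ;;
     incr 19).

(* The initial budget [2 d0 + 2] with [d0 + 1] changes never restricts the guess
   of row 0 and makes [solve] start with the budget [d0]. *)
Definition conrmc :=
  If (Var 1)
    (If (Var 2)
       (If (Var 0)
          (initialise ;;
           Assign 15 (Add (Get 0 (Const 0)) (Var 4)) ;; find ;;
           If (Eq (Var 18) (Var 0))
             (Assign 6 (Var 4) ;;
              Assign 8 (Add (Get 0 (Const 0)) (Const 1)) ;;
              Assign 7 (Add (Var 8) (Var 8)) ;;
              Assign 9 (Const 1) ;; search)
             (Assign 0 (Const 0)))
          (Assign 0 (Const 1)))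
       (Assign 0 (Const 0)))
    (Assign 0 (Const 1)).

Ltac next := apply: runs_seq.

(** * Distances to the rows and the elementary routines *)

Section Machine.
Variables (W n l sigma D K : nat) (d M : nat -> nat).
Let S i j := M (i * l + j).

Definition row_dist (t : nat -> nat) i := \sum_(j < l) mism (S i j) (t j).

Lemma row_dist_le t i : row_dist t i <= l.
Proof.
apply: (leq_trans (n := \sum_(j < l) 1)); last by rewrite sum1_card card_ord.
by apply: leq_sum => j _; exact: leq_b1.
Qed.

(** Stated additively because [Sub] truncates: [set_cell] adds the new mismatch before it subtracts
    the old one, and this equation makes that subtraction exact. *)
Lemma row_dist_upd t i j a : j < l ->
  row_dist (upd t j a) i + mism (S i j) (t j) = row_dist t i + mism (S i j) a.
Proof.
move=> Hj; rewrite /row_dist (bigD1 (Ordinal Hj)) // [in RHS](bigD1 (Ordinal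
  Hj)) //=.
rewrite {1}/upd eqxx addnAC [RHS]addnAC; congr (_ + _); first by rewrite addnC.
by apply: eq_bigr => x; rewrite -val_eqE /upd /= => /negbTE ->.
Qed.

Definition hd (u v : nat -> nat) := \sum_(j < l) (u j != v j).

Lemma row_dist_triangle u v i :
  (forall j, j < l -> 0 < v j) -> row_dist u i <= row_dist v i + hd v u.
Proof.
move=> Hv; rewrite -big_split; apply: leq_sum => j _ /=.
by have := Hv j (ltn_ord j); rewrite /mism; lia.
Qed.

(** Stored values are row numbers, letters, distances, budgets and queue positions. Each of at most
    [D.+1] nested budgets lengthens the queue by at most [l], whence the product; the factor 4
    leaves room for the guessed columns and the initial budget. *)
Hypothesis W_big : n + sigma + 4 * (D.+1 * l.+1) < W.
Hypothesis d_le : forall i, i < n -> d i <= D.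
Hypothesis S_le : forall i j, i < n -> j < l -> S i j <= sigma.

Definition input s :=
  [/\ var s 0 = n, var s 1 = l, var s 2 = sigma, arr s 0 = d & arr s 1 = M].

Definition dist_ok s := forall i, i < n -> arr s 3 i = row_dist (arr s 2) i.

Lemma set_cell_spec s j a :
  input s -> dist_ok s -> var s 11 = j -> var s 12 = a -> j < l ->
  arr s 2 j <= sigma -> a <= sigma ->
  runs W set_cell s (fun t s' =>
    [/\ t <= 100 * n.+1, frame [:: 10; 13; 16; 17] [:: 2; 3] s s',
        arr s' 2 = upd (arr s 2) j a, dist_ok s' &
        var s' 13 = \sum_(i < n) (S i j != a)]).
Proof.
move=> [n_ l_ s_ d_ M_] ds j_ a_ jl tj Ha.
have Wl : n + sigma + l < W by nia.
next; apply: runs_assign; first by rewrite /= j_; lia.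
next; apply: runs_assign; first by rewrite /=; lia.
next; apply: runs_assign; first by rewrite /=; lia.
set s0 := set_var _ _ _.
pose I i s1 := [/\ frame [:: 10; 13; 16; 17] [:: 3] s s1,
   var s1 10 = i /\ var s1 17 = arr s 2 j, var s1 13 = \sum_(x < i) (S x j !=
     a) &
   forall x, x < n -> arr s1 3 x =
     row_dist (if x < i then upd (arr s 2) j a else arr s 2) x].
next; apply: (runs_weaken (P := fun t s1 => t <= 3.+1 + n * (3.+1 + 60) /\ I n
  s1)).
  apply: runs_for.
  - move=> i s1 Hi [[F _] [i_ _] _ _] /=.
    by rewrite i_ F //= n_.
  - move=> i s1 Hi [[F G] [i_ o_] m_ D_].
    have e1 : eval s1 (entry (Var 10) (Var 11)) = S i j.
      by rewrite /= i_ !F //= G //= M_ l_ j_.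
    have Sl := S_le Hi jl.
    next; apply: runs_assign; first by rewrite e1; lia.
    rewrite e1.
    have D0 : arr s1 3 i = row_dist (arr s 2) i by rewrite D_ // ltnn.
    have U := row_dist_upd (arr s 2) i a jl.
    have L := row_dist_le (upd (arr s 2) j a) i.
    set s2 := set_var s1 _ _.
    have e2 : eval s2 (Sub (Add (Get 3 (Var 10)) (emism (Var 16) (Var 12)))
                (emism (Var 16) (Var 17))) = row_dist (upd (arr s 2) j a) i.
      cbn [eval]; rewrite !eval_emism /= i_ F //= o_ D0 a_; move: U;
        rewrite /S; lia.
    next; apply: runs_store; first by rewrite e2; lia.
    rewrite e2 /s2; next; apply: runs_assign.
      cbn [eval]; rewrite eval_ne /= (F 12) //= a_ m_.
      have : \sum_(x < i) (S x j != a) <= \sum_(x < i) 1.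
        by apply: leq_sum => x _; exact: leq_b1.
      by rewrite sum1_card card_ord; lia.
    apply: runs_assign; first by rewrite /= i_; lia.
    cbn [eval]; rewrite eval_ne /=; split; first lia.
    split=> //=.
    + by fr.
    + by rewrite i_ addn1.
    + by rewrite big_ord_recr /= (F 12) //= a_ m_.
    + move=> x Hx; rewrite i_; case: eqP => [->|Hn]; first by rewrite ltnSn.
      by rewrite D_ // (_ : (x < i.+1) = (x < i)) //; lia.
  - by split=> //=; [fr|rewrite j_|rewrite big_ord0].
move=> t1 s1 [T1 [[F G] [i_ o_] m_ D_]].
apply: runs_store; first by rewrite /= F //= a_; lia.
have j1 : var s1 11 = j by rewrite F.
have a1 : var s1 12 = a by rewrite F.
split; rewrite /= ?j1 ?a1 ?m_ //.
- lia.
- by fr; apply: frame_sub (conj F G).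
- by apply: functional_extensionality => x; rewrite /upd G.
- move=> x Hx /=; rewrite D_ // Hx; congr row_dist.
  by apply: functional_extensionality => y; rewrite /upd G //= j1 a1.
Qed.

Lemma find_spec s bb :
  input s -> dist_ok s -> var s 15 = bb ->
  runs W find s (fun t s' =>
    [/\ t <= 50 * n.+1, frame [:: 10; 18] [::] s s' &
      (var s' 18 = n /\ forall i, i < n -> row_dist (arr s 2) i <= d i + bb) \/
      (var s' 18 < n /\
       d (var s' 18) + bb < row_dist (arr s 2) (var s' 18))]).
Proof.
move=> [n_ l_ s_ d_ M_] ds b_.
next; apply: runs_assign; first by rewrite /= n_; lia.
next; apply: runs_assign; first by rewrite /=; lia.
set s0 := set_var _ _ _.
pose I i s1 := [/\ frame [:: 10; 18] [::] s s1, var s1 10 = i &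
  (var s1 18 = n /\ forall x, x < i -> row_dist (arr s 2) x <= d x + bb) \/
  (var s1 18 < n /\ d (var s1 18) + bb < row_dist (arr s 2) (var s1 18))].
apply: (runs_weaken (P := fun t s1 => t <= 3.+1 + n * (3.+1 + 40) /\ I n s1)).
  apply: runs_for.
  - by move=> i s1 Hi [[F _] i_ _] /=; rewrite i_ F //= n_.
  - move=> i s1 Hi [[F G] i_ f_].
    next; apply: runs_if => /=; rewrite i_ !G // d_ F //= b_ ds // => Ht.
      apply: runs_assign; first by rewrite /=; lia.
      rewrite /= i_; apply: runs_assign; first by rewrite /= i_; lia.
      split; rewrite /= ?i_; first lia.
      split=> /=.
      + by fr.
      + by rewrite addn1.
      + by right; split=> //; move: Ht; lia.
    apply: runs_skip; apply: runs_assign; first by rewrite /= i_; lia.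
    split; rewrite /= ?i_; first lia.
    split=> /=.
    + by fr.
    + by rewrite addn1.
    + case: f_ => [[fn f_]|[f1 f2]]; [left|by right]; split=> // x Hx.
      have [/eqP ->|ne] := boolP (x == i); last by apply: f_; lia.
      by move: Ht; lia.
  - split; [by fr|done|by left; rewrite /= n_].
by move=> t s1 [T1 [F _ f_]]; split=> //=; lia.
Qed.

Definition items s q m := [seq arr s 5 x | x <- iota q m].

Lemma scan_spec s R f e :
  input s -> var s 3 = size R -> arr s 4 =1 nth 0 R -> {in R, forall x, x < l}
    ->
  var s 18 = f -> f < n -> var s 6 = e -> e + l < W -> size R <= l ->
  let L := [seq x <- R | S f x != arr s 2 x] in
  runs W scan s (fun t s' =>
    [/\ t <= 50 * (size R).+1, frame [:: 6; 11; 14] [:: 5] s s',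
        var s' 6 = e + size L, items s' e (size L) = L &
        forall x, x < e -> arr s' 5 x = arr s 5 x]).
Proof.
move=> [n_ l_ s_ d_ M_] r_ R_ Rl f_ fn e_ eW Rs L.
have Wl : n + sigma + l < W by nia.
pose LL p := [seq x <- take p R | S f x != arr s 2 x].
next; apply: runs_assign; first by rewrite /=; lia.
set s0 := set_var _ _ _.
pose I p s1 := [/\ frame [:: 6; 11; 14] [:: 5] s s1, var s1 14 = p,
  var s1 6 = e + size (LL p), items s1 e (size (LL p)) = LL p &
  forall x, x < e -> arr s1 5 x = arr s 5 x].
apply: (runs_weaken
  (P := fun t s1 => t <= 3.+1 + size R * (3.+1 + 40) /\ I (size R) s1)).
  apply: runs_for.
  - by move=> i s1 Hi [[F _] i_ _ _ _] /=; rewrite i_ F //= r_.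
  - move=> p s1 Hp [[F G] p_ e1 it_ fr].
    have j_ : eval s1 (Get 4 (Var 14)) = nth 0 R p by rewrite /= p_ G // R_.
    have Hj : nth 0 R p < l by apply: Rl; rewrite mem_nth.
    have eL : LL p.+1 = if S f (nth 0 R p) != arr s 2 (nth 0 R p)
                        then rcons (LL p) (nth 0 R p) else LL p.
      rewrite /LL (take_nth 0) // filter_rcons; by case: ifP.
    have szL : size (LL p) <= p.
      rewrite /LL size_filter; apply: leq_trans (count_size _ _) _.
      by rewrite size_take Hp.
    next; apply: runs_assign; first by rewrite j_; lia.
    rewrite j_; set j := nth 0 R p in Hj eL *.
    next; apply: runs_if; rewrite eval_ne /= !F //= !G //= M_ l_ f_ -/(S f j)
      => Ht.
      next; apply: runs_store; first by rewrite /=; lia.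
      rewrite /=; apply: runs_assign; first by rewrite /= e1; lia.
      rewrite /=; apply: runs_assign; first by rewrite /= p_; lia.
      have {}eL : LL p.+1 = rcons (LL p) j by rewrite eL; case: (S f j != _) Ht.
      split; rewrite /= ?e1 ?p_ ?addn1; first lia.
      split; rewrite /= ?eL ?size_rcons ?addnS //.
      + by fr.
      + have iS : iota e (size (LL p)).+1 = rcons (iota e (size (LL p))) (e +
        size (LL p)).
          by rewrite -[in LHS]addn1 iotaD cats1.
        rewrite /items iS map_rcons /= eqxx; congr rcons.
        rewrite -[RHS]it_; apply/eq_in_map => x; rewrite mem_iota => Hx /=.
        by have /negbTE -> : x != e + size (LL p) by lia.
      + move=> x Hx; rewrite fr //.
        by have /negbTE -> : x != e + size (LL p) by lia.
    apply: runs_skip; apply: runs_assign; first by rewrite /= p_; lia.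
    have {}eL : LL p.+1 = LL p by rewrite eL; case: (S f j != _) Ht.
    split; rewrite /= ?p_ ?addn1; first lia.
    split; rewrite /= ?eL //.
    by fr.
  - split; rewrite /= /LL ?take0 ?addn0 //.
    by fr.
move=> t s1 [T1 [F p_ e1 it_ fr]]; rewrite /LL take_size in e1 it_.
by split=> //=; lia.
Qed.

(** * The initial string and the columns to inspect *)

Hypotheses (n_gt0 : 0 < n) (sigma_gt0 : 0 < sigma).

Definition start j := if S 0 j == 0 then 1 else S 0 j.
Definition missing_cols m := [seq j <- iota 0 m | S 0 j == 0].
(** A missing entry, coded 0, differs from every starting letter, so a column with a missing entry
    is mixed. Outside these columns all rows carry the letter of [start]. *)
Definition mixed_cols m :=
  [seq j <- iota 0 m | \sum_(i < n) (S i j != start j) != 0].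

Lemma start_bounds j : j < l -> 0 < start j <= sigma.
Proof.
move=> jl; have := S_le n_gt0 jl; rewrite /start.
by case: eqP => [_ _|/eqP N H]; [rewrite sigma_gt0|rewrite lt0n N].
Qed.

Lemma filter_iotaS (p : pred nat) m :
  [seq j <- iota 0 m.+1 | p j] =
  if p m then rcons [seq j <- iota 0 m | p j] m else [seq j <- iota 0 m | p j].
Proof. by rewrite -addn1 iotaD filter_cat /=; case: (p m);
  rewrite ?cats1 ?cats0. Qed.

Lemma initialise_spec s :
  input s -> (forall x, 2 < x -> var s x = 0) ->
  (forall a x, 1 < a -> arr s a x = 0) ->
  runs W initialise s (fun t s' =>
    [/\ t <= 4 + l * (200 * n.+1), input s' /\ var s' 5 = 0, dist_ok s',
        forall j, j < l -> arr s' 2 j = start j &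
      [/\ var s' 3 = size (mixed_cols l), var s' 4 = size (missing_cols l),
          arr s' 4 =1 nth 0 (mixed_cols l) &
          items s' 0 (size (missing_cols l)) = missing_cols l]]).
Proof.
move=> [n_ l_ s_ d_ M_] var0 arr0.
have Wl : n + sigma + l + 2 < W by nia.
have sz (p : pred nat) m : size [seq j <- iota 0 m | p j] <= m.
  by rewrite size_filter (leq_trans (count_size _ _)) ?size_iota.
pose I m s1 :=
  [/\ frame [:: 3; 4; 10; 11; 12; 13; 16; 17; 19] [:: 2; 3; 4; 5] s s1,
      var s1 19 = m, dist_ok s1,
      forall x, arr s1 2 x = if x < m then start x else 0 &
    [/\ var s1 3 = size (mixed_cols m), var s1 4 = size (missing_cols m),
        arr s1 4 =1 nth 0 (mixed_cols m) &
        items s1 0 (size (missing_cols m)) = missing_cols m]].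
apply: (runs_weaken (P := fun t s1 => t <= 4 + l * (4 + (100 * n.+1 + 60)) /\ I
  l s1)).
  apply: runs_for.
  - by move=> m s1 _ [[F _] m_ _ _ _] /=; rewrite m_ F //= l_.
  - move=> m s1 ml [[F G] m_ ds t_ [r_ k_ R_ it_]].
    next; apply: runs_assign; first by rewrite /= m_; lia.
    rewrite /= m_.
    have Sm := S_le n_gt0 ml.
    next; apply: runs_assign; first by rewrite /= G // F // M_ l_;
      apply: leq_ltn_trans Sm _; lia.
    rewrite /= G // F // M_ l_ -/(S 0 m).
    set s2 := set_var _ _ _.
    have szm : size (missing_cols m) <= m by exact: sz.
    next; apply: (runs_weaken (P := fun t s3 =>
      [/\ t <= 20, frame [:: 4; 11; 12] [:: 5] s1 s3, var s3 11 = m,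
          var s3 12 = start m & var s3 4 = size (missing_cols m.+1) /\
          items s3 0 (size (missing_cols m.+1)) = missing_cols m.+1])).
      apply: runs_if => /= Hm.
        apply: runs_skip; split=> //=; first by fr.
          by rewrite /start (negbTE Hm).
        by rewrite /missing_cols filter_iotaS (negbTE Hm).
      next; apply: runs_assign; first by rewrite /=; lia.
      rewrite /=; next; apply: runs_store; first by rewrite /=; lia.
      rewrite /=; apply: runs_assign; first by rewrite /= k_; lia.
      rewrite /= k_; split=> //=; first by fr.
        by rewrite /start Hm.
      rewrite /missing_cols filter_iotaS Hm /= -/(missing_cols m) size_rcons
        addn1.
      split=> //; rewrite /items.
      have -> : iota 0 (size (missing_cols m)).+1 =
          rcons (iota 0 (size (missing_cols m))) (size (missing_cols m)).
        by rewrite -[in LHS]addn1 iotaD cats1.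
      rewrite map_rcons /= eqxx; congr rcons; rewrite -[RHS]it_.
      apply/eq_in_map => x; rewrite mem_iota => Hx /=.
      by have /negbTE -> : x != size (missing_cols m) by lia.
    move=> t3 s3 [T3 [F3 G3] j3 a3 [k3 it3]].
    have in3 : input s3 by split; rewrite ?F3 ?G3 ?F ?G.
    have ds3 : dist_ok s3 by move=> i Hi; rewrite !G3 // ds.
    have /andP [st1 st2] := start_bounds ml.
    next; apply: (runs_weaken (set_cell_spec in3 ds3 j3 a3 ml _ st2)).
      by rewrite G3 // t_ ltnn.
    move=> t4 s4 [T4 [F4 G4] t4_ ds4 m4].
    have szx : size (mixed_cols m) <= m by exact: sz.
    have r4 : var s4 3 = size (mixed_cols m) by rewrite F4 // F3.
    have R4 : arr s4 4 = arr s1 4 by rewrite G4 // G3.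
    next; apply: (runs_weaken (P := fun t s5 =>
      [/\ t <= 20, frame [:: 3] [:: 4] s4 s5,
          var s5 3 = size (mixed_cols m.+1) &
          arr s5 4 =1 nth 0 (mixed_cols m.+1)])).
      apply: runs_if; rewrite /= m4 => Hm.
        next; apply: runs_store; first by rewrite /= F4 // j3; lia.
        rewrite /=; apply: runs_assign; first by rewrite /= r4; lia.
        rewrite /= r4 F4 // j3 /mixed_cols filter_iotaS Hm -/(mixed_cols m).
        split=> //; first by fr.
          by rewrite size_rcons /= addn1.
        move=> x /=; rewrite nth_rcons R4 R_; case: eqP => [->|_].
          by rewrite ltnn.
        by case: ltnP => // Hx; rewrite nth_default.
      apply: runs_skip; split=> //=.
        by rewrite /mixed_cols filter_iotaS Hm.
      by move=> x; rewrite /mixed_cols filter_iotaS Hm R4 R_.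
    move=> t5 s5 [T5 [F5 G5] r5 R5].
    have m5 : var s5 19 = m by rewrite F5 // F4 // F3.
    apply: runs_assign; first by rewrite /= m5; lia.
    rewrite /= m5 [m + 1]addn1; split; first by lia.
    split=> //=.
    + split=> [x|y] Hx.
        rewrite /= (_ : (x == 19) = false); last by move: Hx; rewrite !inE; lia.
        rewrite F5 ?F4 ?F3 ?F //; move: Hx; rewrite !inE; lia.
      rewrite /= G5 ?G4 ?G3 ?G //; move: Hx; rewrite !inE; lia.
    + by move=> i Hi /=; rewrite !G5 // ds4.
    + move=> x; rewrite G5 // t4_ /upd G3 // t_.
      case: eqP => [->|N]; first by rewrite ltnSn.
      by rewrite (_ : (x < m.+1) = (x < m)) //; lia.
    + split=> //=; first by rewrite F5 // F4.
      by rewrite -[RHS]it3 /items /= G5 // G4.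
  - split=> //=.
    + exact: var0.
    + move=> i Hi; rewrite arr0 // /row_dist big1 // => j _.
      by rewrite arr0 // /mism andbF.
    + by move=> x; rewrite arr0.
    + split=> //=; rewrite ?var0 //.
      by move=> x; rewrite arr0 // nth_nil.
move=> t s1 [T1 [[F G] m_ ds t_ H]]; split=> //.
- by nia.
- by split; [split; rewrite ?F ?G|rewrite F // var0].
- by move=> j jl; rewrite t_ jl.
Qed.

(** * States of the search and what a subsearch guarantees *)

Variables (R : seq nat) (k0 : nat) (t0 : nat -> nat).
Hypotheses (R_uniq : uniq R) (R_lt : {in R, forall j, j < l}).
Hypothesis S_off_R :
  forall i j, i < n -> j < l -> j \notin R -> S i j = t0 j.

Definition base s := [/\ input s, var s 3 = size R, var s 4 = k0
                       & arr s 4 =1 nth 0 R].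
(** Off [R] every row holds [t0 j], so keeping that letter never creates a mismatch. Solutions are
    not confined in this way; their changes off [R] are counted by [hd]. *)
Definition valid (t : nat -> nat) :=
  forall j, j < l -> 0 < t j <= sigma /\ (j \notin R -> t j = t0 j).
Definition inv s := [/\ base s, dist_ok s & valid (arr s 2)].

Definition saved s q o c e b w :=
  [/\ arr s 6 q = o, arr s 7 q = c, arr s 8 q = e, arr s 9 q = b
    & arr s 10 q = w].

(** The part of the memory that belongs to the callers: queue entries before [e] and restore records
    (arrays 6 to 10) of positions before [q]. Everything beyond may be overwritten. *)
Definition keeps q e (s s' : state) :=
  (forall x, x < e -> arr s' 5 x = arr s 5 x) /\
  (forall a x, 5 < a < 11 -> x < q -> arr s' a x = arr s a x).

Definition good v :=
  (forall j, j < l -> 0 < v j <= sigma) /\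
  (forall i, i < n -> row_dist v i <= d i).

(* [s'] is reached from [s] by complete iterations of the main loop. *)
Definition reach s t s' :=
  forall t' s2, exec W search s' t' s2 -> exec W search s (t + t') s2.

(** [P] claims that the subtree contains a solution. Success ends the whole run, so the first exit
    says nothing about the subtree; only the return in backtracking mode has to refute [P], with the
    string [t] restored. *)
Definition explores s q e t X (P : Prop) :=
  exists T s', [/\ reach s T s', T <= X &
    [/\ var s' 9 = 0, 0 < var s' 0 & exists v, good v] \/
    [/\ inv s', var s' 9 = 2, var s' 5 = q, arr s' 2 = t & keeps q e s s' /\ ~
      P]].

Definition conf s md q e b w :=
  inv s /\ [/\ var s 9 = md, var s 5 = q, var s 6 = e, var s 7 = b & var s 8 =
    w].

Lemma base_frame xs ys s s' :
  all (leq 5) xs -> all (predC (mem [:: 0; 1; 4])) ys ->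
  frame xs ys s s' -> base s -> base s'.
Proof.
move=> /allP Hx /allP Hy [F G] [[n_ l_ s_ d_ M_] r_ k_ R_].
have Fx x : x < 5 -> var s' x = var s x.
  by move=> Hlt; apply: F; apply/negP => /Hx; lia.
have Gy y : y \in [:: 0; 1; 4] -> arr s' y = arr s y.
  by move=> Hin; apply: G; apply/negP => /Hy /=; rewrite Hin.
by split; [split|..]; rewrite ?Fx ?Gy.
Qed.

Lemma inv_frame xs ys s s' :
  all (leq 5) xs -> all (leq 5) ys -> frame xs ys s s' -> inv s -> inv s'.
Proof.
move=> Hx Hy Hf [b_ d_ v_].
have [F G] := Hf; have Gy y : y < 5 -> arr s' y = arr s y.
  by move=> Hlt; apply: G; apply/negP => /(allP Hy); lia.
split.
- apply: base_frame Hf b_ => //; apply: sub_all Hy => y /=.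
  by rewrite !inE; lia.
- by move=> i Hi; rewrite !Gy // d_.
- by rewrite Gy.
Qed.

(** The two extra units are the guard [Var 9] and the loop step itself. *)
Lemma reach_step s (Q : nat -> state -> Prop) :
  var s 9 != 0 -> runs W search_step s Q ->
  exists t s', reach s t.+2 s' /\ Q t s'.
Proof.
move=> H9 [t [s' [He HQ]]]; exists t, s'; split=> // t' s2 Hs.
exact: (exec_while_step (e := Var 9) H9 He Hs).
Qed.

Lemma reach_trans s1 s2 s3 t1 t2 :
  reach s1 t1 s2 -> reach s2 t2 s3 -> reach s1 (t1 + t2) s3.
Proof. by move=> H1 H2 t' s' He; rewrite -addnA; apply: H1; apply: H2. Qed.

Lemma keeps_trans q e q' e' s1 s2 s3 : q <= q' -> e <= e' ->
  keeps q e s1 s2 -> keeps q' e' s2 s3 -> keeps q e s1 s3.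
Proof.
move=> Hq He [A1 A2] [B1 B2]; split=> [x Hx|a x Ha Hx].
  by rewrite B1 ?A1 //; lia.
by rewrite B2 ?A2 //; lia.
Qed.

(** * Deciding one column *)

Definition item_time := 200 * n.+1.

Lemma descend_spec s q e b w :
  conf s 1 q e b w -> q < e -> e < W -> b < W -> w < W ->
  arr s 5 q < l ->
  exists T s', [/\ reach s T s', T <= item_time, conf s' 1 q.+1 e b w,
    keeps q e s s' /\ arr s' 2 = arr s 2 &
    arr s' 5 = arr s 5 /\ saved s' q (arr s 2 (arr s 5 q)) (q < k0) e b w].
Proof.
move=> [Hi [m_ q_ e_ b_ w_]] qe eW bW wW pl.
have tW : arr s 2 (arr s 5 q) < W by have [_ _ /(_ _ pl)] := Hi; nia.
suff: runs W search_step s (fun t s' => [/\ t <= 100,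
     frame [:: 5] [:: 6; 7; 8; 9; 10] s s', var s' 5 = q.+1,
     (forall a x, 5 < a < 11 -> x < q -> arr s' a x = arr s a x) &
     saved s' q (arr s 2 (arr s 5 q)) (q < k0) e b w]).
  case/reach_step; first by rewrite m_.
  move=> t [s' [Hr [Ht Hf q1 fr sv]]]; have [F G] := Hf.
  exists t.+2, s'; split=> //; first by rewrite /item_time; lia.
  - by split; [apply: inv_frame Hf Hi|split=> //; rewrite F].
  - by split; [split=> [x Hx|]; [rewrite G|exact: fr]|rewrite G].
  - by rewrite G.
have k_ : var s 4 = k0 by have [[]] := Hi.
apply: runs_if; rewrite /= ?m_ //= => _.
apply: runs_if; rewrite /= ?q_ ?e_; first by case: eqP => //; lia.
move=> _; next; apply: runs_store; first by rewrite /= q_.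
next; apply: runs_store; first by rewrite /=; lia.
next; apply: runs_store; first by rewrite /= e_.
next; apply: runs_store; first by rewrite /= b_.
next; apply: runs_store; first by rewrite /= w_.
apply: runs_assign; first by rewrite /= q_; lia.
rewrite /= q_; split=> //=; last by split; rewrite /= ?eqxx // k_.
- by fr.
- by rewrite addn1.
- move=> a x Ha Hx.
  by do !case: ifP => [/andP [_ /eqP E]|_]; try lia.
Qed.

Lemma saved_eq s s' q o c e b w :
  (forall a, 5 < a < 11 -> arr s' a q = arr s a q) ->
  saved s q o c e b w -> saved s' q o c e b w.
Proof. by move=> E [? ? ? ? ?]; split; rewrite E. Qed.

Lemma inv_set_cell s s' j a :
  inv s -> frame [:: 10; 13; 16; 17] [:: 2; 3] s s' ->
  arr s' 2 = upd (arr s 2) j a -> dist_ok s' -> j \in R -> 0 < a <= sigma ->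
  inv s'.
Proof.
move=> [b_ _ v_] Hf t_ d_ jR a_; split=> //; first exact: base_frame Hf b_.
rewrite t_ /upd => x Hx; case: eqP => [->|_]; last exact: v_.
by rewrite jR.
Qed.

(** A change is charged only at positions from [k0] on, since guessing missing entries of row 0 is
    free. The record keeps the [w] from before the choice, so siblings do not accumulate charges.
    The old letter is among those tried, hence a factor [sigma] and not [sigma - 1]. *)
Lemma backtrack_spec s q o c e b w j :
  inv s -> var s 9 = 2 -> var s 5 = q.+1 -> saved s q o c e b w ->
  arr s 5 q = j -> j \in R -> 0 < o <= sigma ->
  q < e -> e < W -> b < W -> w < W ->
  exists T s', [/\ reach s T s', T <= item_time, keeps q e s s', arr s' 5 = arr
    s 5 &
    if (c < sigma) && (w < b) then
      [/\ conf s' 1 q.+1 e b (w + (k0 <= q)), arr s' 2 = upd (arr s 2) j c.+1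
        & saved s' q o c.+1 e b w]
    else [/\ inv s', var s' 9 = 2, var s' 5 = q & arr s' 2 = upd (arr s 2) j
      o]].
Proof.
move=> Hi m_ q_ [o_ c_ e_ b_ w_] j_ jR Ho qe eW bW wW.
have jl := R_lt jR; have [[[n_ l_ s_ d_ M_] r_ k_ R_] ds vt] := Hi.
have Ws : sigma < W by nia.
have {vt} tj : arr s 2 j <= sigma by have [/andP []] := vt _ jl.
have {Ho} [Ho1 Ho2] : 0 < o /\ o <= sigma by lia.
suff: runs W search_step s (fun t s' => [/\ t <= 100 * n.+1 + 98,
    keeps q e s s', arr s' 5 = arr s 5 &
    if (c < sigma) && (w < b) then
      [/\ conf s' 1 q.+1 e b (w + (k0 <= q)), arr s' 2 = upd (arr s 2) j c.+1
        & saved s' q o c.+1 e b w]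
    else [/\ inv s', var s' 9 = 2, var s' 5 = q & arr s' 2 = upd (arr s 2) j
      o]]).
  case/reach_step; first by rewrite m_.
  move=> t [s' [Hr [Ht Hk H5 Hs]]]; exists t.+2, s'; split=> //.
  by rewrite /item_time; lia.
apply: runs_if; rewrite /= ?m_ //= => _.
apply: runs_if; rewrite /= ?q_ //= => _.
next; apply: runs_assign; first by rewrite /= q_; lia.
rewrite /= q_ subSS subn0.
next; apply: runs_assign; first by rewrite /= e_.
rewrite /= e_.
next; apply: runs_assign; first by rewrite /= b_.
rewrite /= b_.
next; apply: runs_assign; first by rewrite /= w_.
rewrite /= w_.
next; apply: runs_assign; first by rewrite /= j_; nia.
rewrite /= j_.
set s1 := set_var _ _ _.
have Hf : frame [:: 5; 6; 7; 8; 11] [::] s s1 by fr.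
have Ec : eval s1 (Mul (Lt (Get 7 (Var 5)) (Var 2)) (Lt (Var 8) (Var 7)))
          = (c < sigma) && (w < b) by rewrite /= c_ s_ mulnb.
apply: runs_if; rewrite Ec => Hc.
  have {Hc}Hc : (c < sigma) && (w < b) by case: (_ && _) Hc.
  rewrite Hc; case/andP: Hc => Hc Hw.
  next; apply: runs_assign; first by rewrite /= c_; lia.
  rewrite /= c_ addn1.
  next; apply: runs_store; first by rewrite /=; lia.
  rewrite /=.
  next; apply: runs_assign; first by rewrite /= k_; lia.
  rewrite /= k_ addn1 ltnS.
  set s2 := set_var _ _ _.
  have Hf2 : frame [:: 5; 6; 7; 8; 11; 12] [:: 7] s s2.
    by fr; apply: frame_sub Hf.
  have i2 : inv s2 by apply: inv_frame Hf2 Hi.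
  have [b2 d2 _] := i2; have [in2 _ _ _] := b2.
  next; apply: (runs_weaken (set_cell_spec (j := j) (a :=
    c.+1) in2 d2 _ _ _ _ _)) => //.
  move=> t3 s3 [T3 f3 t3_ d3 _].
  have i3 : inv s3 by apply: inv_set_cell i2 f3 t3_ d3 jR _.
  have [F3 G3] := f3.
  next; apply: runs_assign; first by rewrite /= F3 //=; lia.
  apply: runs_assign; first by rewrite /=; lia.
  rewrite /= F3 //= addn1; split.
  - by lia.
  - split=> [x Hx|a x Ha Hx] /=; rewrite G3 ?inE //=; try lia.
    by case: eqP => //= _; case: eqP => //=; lia.
  - by rewrite /= G3.
  split.
  - split; last by split; rewrite /= ?F3 ?addn1.
    by apply: (inv_frame (xs := [:: 5; 9]) (ys := [::])) i3; fr.
  - by rewrite /= t3_.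
  - by split; rewrite /= G3 // /s2 /= ?eqxx.
have -> : (c < sigma) && (w < b) = false by case: (_ && _) Hc.
next; apply: runs_assign; first by rewrite /= o_; lia.
rewrite /= o_; set s2 := set_var _ _ _.
have Hf2 : frame [:: 5; 6; 7; 8; 11; 12] [::] s s2.
  by fr; apply: frame_sub Hf.
have i2 : inv s2 by apply: inv_frame Hf2 Hi.
have [b2 d2 _] := i2; have [in2 _ _ _] := b2.
apply: (runs_weaken (set_cell_spec (j := j) (a := o) in2 d2 _ _ _ _ _)) => //.
move=> t3 s3 [T3 f3 t3_ d3 _]; have [F3 G3] := f3.
split.
- by lia.
- split=> [x Hx|a x Ha Hx] /=; rewrite G3 ?inE //=; lia.
- by rewrite G3.
split; rewrite ?F3 //.
by apply: inv_set_cell i2 f3 t3_ d3 jR _; rewrite Ho1.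
Qed.

Lemma upd_upd t j a b : upd (upd t j a) j b = upd t j b.
Proof. by apply: functional_extensionality => x; rewrite /upd; case: eqP. Qed.

Lemma upd_id t j : upd t j (t j) = t.
Proof. by apply: functional_extensionality => x; rewrite /upd;
  case: eqP => [->|]. Qed.

(** Induction on the number [r] of letters left to try. Between siblings the string differs from [t]
    at most at [j], which is why the one saved letter restores it. *)
Lemma siblings_explore s q e t j b w X (P : nat -> Prop) :
  j \in R -> 0 < t j <= sigma -> q < e -> e < W -> b < W -> w < W ->
  (forall c s1, 0 < c <= sigma -> w < b ->
     conf s1 1 q.+1 e b (w + (k0 <= q)) -> keeps q e s s1 ->
     arr s1 2 = upd t j c -> explores s1 q.+1 e (upd t j c) X (P c)) ->
  forall r c s1, sigma - c = r -> inv s1 -> var s1 9 = 2 -> var s1 5 = q.+1 ->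
    saved s1 q (t j) c e b w -> arr s1 5 q = j -> keeps q e s s1 ->
    upd (arr s1 2) j (t j) = t ->
    explores s1 q e t (item_time + (if w < b then r * (X + item_time) else 0))
      (exists c', [/\ c < c' <= sigma, w < b & P c']).
Proof.
move=> jR tj qe eW bW wW Hch; elim=> [|r IHr] c s1 Hc i1 m1 q1 sv j1 k1 t1.
  have [T [s2 [Hr HT k2 _]]] := backtrack_spec i1 m1 q1 sv j1 jR tj qe eW bW wW.
  rewrite (_ : c < sigma = false) /=; last by lia.
  rewrite t1 => -[i2 m2 q2 t2].
  exists T, s2; split; [done|lia|right; split=> //].
  by split=> // -[c' [Hc' _ _]]; lia.
have [T [s2 [Hr HT k2 a5]]] := backtrack_spec i1 m1 q1 sv j1 jR tj qe eW bW wW.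
case: ifP => [|Hcw].
  move=> /andP [Hcs Hwb] [c2 t2 sv2].
  rewrite Hwb mulSn.
  have k12 : keeps q e s s2 by apply: keeps_trans k1 k2.
  have Et : arr s2 2 = upd t j c.+1 by rewrite t2 -t1 upd_upd.
  have [T3 [s3 [Hr3 HT3 HQ]]] := Hch c.+1 s2 Hcs Hwb c2 k12 Et.
  have Hr13 := reach_trans Hr Hr3.
  case: HQ => [H|[i3 m3 q3 t3 [k3 nP]]].
    by exists (T + T3), s3; split; [done|lia|left].
  have k23 : keeps q e s2 s3 by have [A B] := k3; split=> // a x Ha Hx;
    apply: B => //; lia.
  have sv3 : saved s3 q (t j) c.+1 e b w.
    by apply: saved_eq sv2 => a Ha; have [_ ->] := k3.
  have j3 : arr s3 5 q = j by have [-> //] := k3; rewrite a5.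
  have t3' : upd (arr s3 2) j (t j) = t by rewrite t3 upd_upd upd_id.
  have [|T4 [s4 [Hr4 HT4 HQ]]] :=
    IHr c.+1 s3 _ i3 m3 q3 sv3 j3 (keeps_trans (leqnn _) (leqnn _) k12 k23) t3'.
    by lia.
  rewrite Hwb in HT4.
  exists (T + T3 + T4), s4; split; [exact: reach_trans Hr13 Hr4|lia|].
  case: HQ => [H|[i4 m4 q4 t4 [k4 nP4]]]; [by left|right; split=> //].
  split.
    exact: keeps_trans (leqnn _) (leqnn _) k2
      (keeps_trans (leqnn _) (leqnn _) k23 k4).
  move=> [c' [Hc' _ HP]]; have [E|N] := eqVneq c' c.+1;
    first by rewrite E in HP.
  by apply: nP4; exists c'; split=> //; lia.
rewrite t1 => -[i2 m2 q2 t2]; exists T, s2; split; [done|lia|right; split=> //].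
by split=> // -[c' [Hc' Hw _]]; lia.
Qed.

(** The visit that keeps the letter comes first and is not charged. At a missing entry of row 0 the
    kept letter is already 1, so there the siblings begin with 2. *)
Lemma item_explores s q e b w X0 X1 P0 (P1 : nat -> Prop) :
  let j := arr s 5 q in
  conf s 1 q e b w -> q < e -> e < W -> b < W -> w < W -> j \in R ->
  (forall s1, conf s1 1 q.+1 e b w -> keeps q e s s1 -> arr s1 2 = arr s 2 ->
     explores s1 q.+1 e (arr s 2) X0 P0) ->
  (forall c s1, 0 < c <= sigma -> w < b ->
     conf s1 1 q.+1 e b (w + (k0 <= q)) -> keeps q e s s1 ->
     arr s1 2 = upd (arr s 2) j c ->
     explores s1 q.+1 e (upd (arr s 2) j c) X1 (P1 c)) ->
  explores s q e (arr s 2)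
    (item_time + X0 + item_time + (if w < b then (sigma - (q < k0)) * (X1 +
      item_time) else 0))
    (P0 \/ exists c, [/\ (q < k0) < c <= sigma, w < b & P1 c]).
Proof.
move=> j Hc qe eW bW wW jR H0 H1.
have jl := R_lt jR; have tj : 0 < arr s 2 j <= sigma.
  by have [[_ _ /(_ _ jl) []]] := Hc.
have [T [s1 [Hr HT c1 [k1 t1] [a1 sv1]]]] := descend_spec Hc qe eW bW wW jl.
have [T2 [s2 [Hr2 HT2 HQ]]] := H0 s1 c1 k1 t1.
have Hr12 := reach_trans Hr Hr2.
case: HQ => [H|[i2 m2 q2 t2 [k2 nP]]].
  by exists (T + T2), s2; split; [done|lia|left].
have k12 : keeps q e s s2 by apply: keeps_trans k1 k2.
have sv2 : saved s2 q (arr s 2 j) (q < k0) e b w.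
  by apply: saved_eq sv1 => a Ha; have [_ ->] := k2.
have j2 : arr s2 5 q = j by have [-> //] := k2; rewrite a1.
have t2' : upd (arr s2 2) j (arr s 2 j) = arr s 2 by rewrite t2 upd_id.
have [T3 [s3 [Hr3 HT3 HQ]]] := siblings_explore jR tj qe eW bW wW H1
   (erefl (sigma - (q < k0))) i2 m2 q2 sv2 j2 k12 t2'.
exists (T + T2 + T3), s3; split; [exact: reach_trans Hr12 Hr3|lia|].
case: HQ => [H|[i3 m3 q3 t3 [k3 nP3]]]; [by left|right; split=> //].
split; first exact: keeps_trans k12 k3.
by case.
Qed.

(** * Columns in which a violated row differs from the string *)

Lemma size_R : size R <= l.
Proof.
rewrite -(size_iota 0 l); apply: uniq_leq_size => // x /R_lt.
by rewrite mem_iota.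
Qed.

Lemma count_R (p : pred nat) :
  (forall j, j < l -> p j -> j \in R) -> count p R = \sum_(j < l) p j.
Proof.
move=> Hp; have -> : \sum_(j < l) p j = count p (iota 0 l).
  rewrite -(big_mkord xpredT (fun j => nat_of_bool (p j))) /index_iota subn0.
  by elim: (iota 0 l) => [|x r IHr]; rewrite ?big_nil // big_cons IHr.
rewrite -!size_filter; apply: perm_size; apply: uniq_perm.
- exact: filter_uniq.
- by apply: filter_uniq; exact: iota_uniq.
move=> j; rewrite !mem_filter mem_iota /= add0n; case pj: (p j) => //=.
by apply/idP/idP => [/R_lt //|jl]; apply: Hp.
Qed.

Definition differing f (t : nat -> nat) := [seq x <- R | S f x != t x].

Definition row_miss i := \sum_(j < l) (S i j == 0).

Lemma differing_big f t v : f < n -> valid t -> good v -> d f < row_dist t f ->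
  hd v t < 2 * count (fun j => v j != t j) (differing f t).
Proof.
move=> fn Ht [v_ Hv] Hd; have Hvf := Hv f fn.
rewrite /differing count_filter count_R; last first.
  move=> j jl /andP [_]; apply: contraR => jR.
  by have [_ ->] := Ht j jl; rewrite // S_off_R.
set c := \sum_(j < l) _.
(* This holds column by column: a change where row [f] agrees with [t] gives [v] a mismatch, and a
   change elsewhere is counted twice, once for itself and once for the mismatch of [t] that it may
   remove. *)
suff: hd v t + row_dist t f <= row_dist v f + 2 * c by lia.
rewrite /c big_distrr -!big_split; apply: leq_sum => j _ /=.
have [/andP [t1 _] _] := Ht j (ltn_ord j); have /andP [v1 _] := v_ j (ltn_ord
  j).
by rewrite /mism; lia.
Qed.

Lemma size_differing f t : f < n -> valid t ->
  size (differing f t) = row_dist t f + row_miss f.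
Proof.
move=> fn Ht; rewrite size_filter count_R; last first.
  move=> j jl; apply: contraR => jR.
  by have [_ ->] := Ht j jl; rewrite // S_off_R.
rewrite -big_split; apply: eq_bigr => j _ /=.
have [/andP [t1 _] _] := Ht j (ltn_ord j); by rewrite /mism; lia.
Qed.

Lemma solve_spec s q b0 w0 (b := minn (b0 - w0) (w0 - 1)) :
  conf s 1 q q b0 w0 -> q + l < W -> b < W ->
  exists T s', [/\ reach s T s', T <= 200 * (n + size R).+1 &
   [\/ [/\ var s' 9 = 0, 0 < var s' 0 &
          forall i, i < n -> row_dist (arr s 2) i <= d i],
       [/\ inv s', var s' 9 = 2, var s' 5 = q, arr s' 2 = arr s 2 &
          keeps q q s s' /\ exists2 i, i < n & d i + b < row_dist (arr s 2) i] |
       exists2 f, [/\ f < n, d f < row_dist (arr s 2) f &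
                     row_dist (arr s 2) f <= d f + b] &
         let L := differing f (arr s 2) in
         [/\ conf s' 1 q (q + size L) b 0, arr s' 2 = arr s 2, keeps q q s s' &
            items s' q (size L) = L]]].
Proof.
move=> [Hi [m_ q_ e_ b_ w_]] qW bW.
suff: runs W search_step s (fun t s' => t <= 50 * n.+1 + 50 * (size R).+1 + 50
  /\
   [\/ [/\ var s' 9 = 0, 0 < var s' 0 &
          forall i, i < n -> row_dist (arr s 2) i <= d i],
       [/\ inv s', var s' 9 = 2, var s' 5 = q, arr s' 2 = arr s 2 &
          keeps q q s s' /\ exists2 i, i < n & d i + b < row_dist (arr s 2) i] |
       exists2 f, [/\ f < n, d f < row_dist (arr s 2) f &
                     row_dist (arr s 2) f <= d f + b] &
         let L := differing f (arr s 2) in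
         [/\ conf s' 1 q (q + size L) b 0, arr s' 2 = arr s 2, keeps q q s s' &
            items s' q (size L) = L]]).
  case/reach_step; first by rewrite m_.
  by move=> t [s' [Hr [Ht H]]]; exists t.+2, s'; split=> //; lia.
have [[[n_ l_ s_ d_ M_] r_ k_ R_] ds vt] := Hi.
apply: runs_if; rewrite /= ?m_ //= => _.
apply: runs_if; rewrite /= ?q_ ?e_ ?eqxx //= => _.
next; apply: (runs_weaken (P := fun t s1 => t <= 20 /\ s1 = set_var s 7 b)).
  apply: runs_if; rewrite /= b_ w_ => Hb.
    have Eb : b0 - w0 = b by move: Hb; rewrite /b; case: ltnP => //; lia.
    by apply: runs_assign; rewrite /= ?b_ ?w_ Eb.
  have Eb : w0 - 1 = b by move: Hb; rewrite /b; case: ltnP => //; lia.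
  by apply: runs_assign; rewrite /= ?b_ ?w_ Eb.
move=> t1 _ [T1 ->].
next; apply: runs_assign; first by rewrite /=; lia.
next; apply: runs_assign; first by rewrite /=; lia.
rewrite /=; set s1 := set_var _ _ _.
have f1 : frame [:: 7; 8; 15] [::] s s1 by fr.
have i1 : inv s1 by apply: inv_frame f1 Hi.
have [[in1 _ _ _] d1 _] := i1.
next; apply: (runs_weaken (find_spec (bb := 0) in1 d1 (erefl _))).
move=> t2 s2 [T2 f2 Hf].
have [F2 G2] := f2.
have i2 : inv s2 by apply: inv_frame f2 i1.
have G2' y : arr s2 y = arr s y by rewrite G2.
have kq s' : (forall y, y != 5 -> arr s' y = arr s y) ->
    (forall x, x < q -> arr s' 5 x = arr s 5 x) -> keeps q q s s'.
  by move=> A B; split=> // a x Ha Hx; have [->|N] := eqVneq a 5;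
    [exact: B|rewrite A].
have [[in2 r2 k2 R2] d2 v2] := i2; have [n2 l2 s2_ dd2 M2] := in2.
apply: runs_if; rewrite /= n2; case: eqP => // H18 _.
  apply: runs_assign; first by rewrite /=; lia.
  split; first by rewrite /=; lia.
  constructor 1; split=> //=; first by rewrite n2.
  case: Hf => [[_ Hf]|[Hf _]]; last by move: H18; lia.
  by move=> i Hi'; have := Hf i Hi'; rewrite addn0.
case: Hf => [[Hf _]|[fn Hf]]; first by case: H18.
rewrite addn0 in Hf.
set f := var s2 18 in Hf fn H18.
have Hf' : d f < row_dist (arr s 2) f by [].
have b2 : var s2 7 = b by rewrite F2.
apply: runs_if; rewrite /= dd2 -/f b2 d2 // G2' => Hd.
  have {}Hd : d f + b < row_dist (arr s 2) f by move: Hd; case: (_ < _).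
  apply: runs_assign; first by rewrite /=; lia.
  split; first by rewrite /=; lia.
  constructor 2; split=> //=.
  - by rewrite F2.
  - by split; [apply: kq => *; rewrite /= G2'|exists f].
have {}Hd : row_dist (arr s 2) f <= d f + b by move: Hd; case: ltnP.
have e2 : var s2 6 = q by rewrite F2.
apply: (runs_weaken (scan_spec in2 r2 R2 R_lt (erefl _) fn e2 qW size_R)).
move=> t3 s3; rewrite -/f G2' -/(differing f (arr s 2)) => -[T3 f3 e3 it3 p3].
have [F3 G3] := f3.
split; first by rewrite /=; lia.
constructor 3; exists f; first by [].
split=> //.
- split; first by apply: inv_frame f3 i2.
  by split; rewrite ?e3 // F3 // F2.
- by rewrite G3 // G2'.
- apply: kq => [y Hy|x Hx]; first by rewrite G3 ?G2' // inE.
  by rewrite p3 // G2'.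
Qed.

Lemma explores_weaken s q e t X Y (P P' : Prop) :
  explores s q e t X P -> X <= Y -> (P' -> P) -> explores s q e t Y P'.
Proof.
move=> [T [s' [Hr HT HQ]]] HY HP; exists T, s'; split; [done|lia|].
case: HQ => [H|[i_ m_ q_ t_ [k_ nP]]]; [by left|right; split=> //].
by split=> // /HP.
Qed.

Lemma hd_upd v t j : j < l -> v j != t j -> hd v t = (hd v (upd t j (v j))).+1.
Proof.
move=> jl vt; rewrite /hd (bigD1 (Ordinal jl)) //= vt.
rewrite [in RHS](bigD1 (Ordinal jl)) //= {1}/upd !eqxx add1n add0n; congr _.+1.
by apply: eq_bigr => x; rewrite -val_eqE /upd /= => /negbTE ->.
Qed.

Lemma items_keeps q e s s' q' m :
  keeps q e s s' -> q' + m <= e -> items s' q' m = items s q' m.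
Proof.
move=> [k_ _] He; apply/eq_in_map => x; rewrite mem_iota => Hx.
by apply: k_; lia.
Qed.

Lemma count_upd v t j c (its : seq nat) : j \notin its ->
  count (fun x : nat => v x != upd t j c x) its =
  count (fun x : nat => v x != t x) its.
Proof.
move=> Hj; apply: eq_in_count => x Hx; rewrite /upd.
by case: (x =P j) Hx => [->|//]; rewrite (negbTE Hj).
Qed.

(** * Weights of search trees and the recursion on the budget *)

Hypothesis miss_le : forall i, i < n -> row_miss i <= K.
Let A := D + K.
Hypothesis R_le : size R <= 2 * (n * A).

Definition node_time := 2000 * (n * A.+1).
Definition nodes b := 'C(A + b, b) * 4 ^ b * sigma ^ b.

(* Each leaf of the decisions on [m] columns with [r] changes left counts for
  the
   binomial factor of the bound [nodes] for the search that starts there. *)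
Fixpoint leaves m r :=
  if m is m'.+1 then leaves m' r + (if r is r'.+1 then leaves m' r' else 0)
  else 'C(A + r, r).

Lemma leavesE m r :
  leaves m r = \sum_(u < r.+1) 'C(m, u) * 'C(A + (r - u), r - u).
Proof.
elim: m r => [|m IHm] r.
  rewrite big_ord_recl /= subn0 bin0 mul1n big1 ?addn0 // => u _.
rewrite /= IHm big_ord_recl [in RHS]big_ord_recl !bin0 -addnA; congr (_ + _).
case: r => [|r]; first by rewrite !big_ord0.
rewrite IHm -big_split /=; apply: eq_bigr => u _.
by rewrite /bump /= !add1n binS subSS mulnDl.
Qed.

Lemma leaves_mono m m' r : m <= m' -> leaves m r <= leaves m' r.
Proof.
elim: m' => [|m' IHm]; first by rewrite leqn0 => /eqP ->.
rewrite leq_eqVlt ltnS => /orP [/eqP -> //|/IHm H] /=.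
exact: leq_trans H (leq_addr _ _).
Qed.

Lemma leaves_gt0 m r : 0 < leaves m r.
Proof. by elim: m => [|m IHm] /=; [rewrite bin_gt0 leq_addl|rewrite addn_gt0
  IHm]. Qed.

(** Both sides are the multinomial coefficient (a+b)! / (a! u! (b-u)!). *)
Lemma bin_mul_bin a b u : u <= b ->
  'C(a + b, u) * 'C(a + (b - u), b - u) = 'C(a + b, b) * 'C(b, u).
Proof.
move=> ub; have F x : 0 < x`! by exact: fact_gt0.
apply/eqP; rewrite -(eqn_pmul2r (F u)) -(eqn_pmul2r (F (b - u))) -(eqn_pmul2r
  (F a)).
have E1 := @bin_fact (a + b) u (leq_trans ub (leq_addl _ _)).
have E2 := @bin_fact (a + (b - u)) (b - u) (leq_addl _ _).
have E3 := @bin_fact (a + b) b (leq_addl _ _).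
have E4 := @bin_fact b u ub.
rewrite addnK in E2; rewrite addnK in E3; rewrite -addnBA // in E1.
apply/eqP; transitivity (a + b)`!.
  rewrite -[RHS]E1 -E2; ring.
rewrite -[LHS]E3 -E4; ring.
Qed.

Lemma leaves_total b : leaves (A + b) b = 'C(A + b, b) * 2 ^ b.
Proof.
rewrite leavesE (eq_bigr (fun u : 'I_b.+1 => 'C(A + b, b) * 'C(b, u)));
  last first.
  by move=> u _; apply: bin_mul_bin; rewrite -ltnS.
rewrite -big_distrr; congr (_ * _); rewrite -[2]/(1 + 1) expnDn.
by apply: eq_bigr => u _; rewrite !exp1n !muln1.
Qed.

(* With [u] further changes on [its], the rest of the distance, [hd v t - u],
  must
   fit in the next budget [min (b - (w + u)) (w + u - 1)]. *)
Definition reachable_solution t its b w :=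
  exists v, [/\ good v, hd v t + w <= b &
    hd v t < w + 2 * count (fun x => v x != t x) its].

(** The induction statement. The term [b.+1 * l] reserves queue space for one list of at most [l]
    columns for each budget from [b] down to 0. *)
Definition solve_ok b := forall s q b0 w0,
  conf s 1 q q b0 w0 -> minn (b0 - w0) (w0 - 1) = b -> k0 <= q ->
  q + b.+1 * l < W ->
  explores s q q (arr s 2) (node_time * nodes b)
    (exists v, good v /\ hd v (arr s 2) <= b).

(** At a leaf with [r] changes left, the factors of [nodes b'] for the next budget b' are at most
    [2 ^ b], [sigma ^ r] and the binomial weight of the leaf. The second summand charges the stack
    operations of the [m] columns to the same weighted leaves. *)
Definition walk_cost b m r := (node_time * 2 ^ b + 2 * m * item_time) * (sigma
  ^ r * leaves m r).

Lemma walk_explores b : b < D -> (forall b', b' <= b -> solve_ok b') ->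
  forall m q w s, conf s 1 q (q + m) b.+1 w -> w <= b.+1 -> k0 <= q ->
  q + m + b.+1 * l < W ->
  uniq (items s q m) -> {subset items s q m <= R} ->
  explores s q (q + m) (arr s 2) (walk_cost b m (b.+1 - w))
    (reachable_solution (arr s 2) (items s q m) b.+1 w).
Proof.
move=> bD IH; elim=> [|m IHm] q w s Hc wb kq qW Hu Hs.
  rewrite addn0 in Hc qW *.
  set b' := minn (b.+1 - w) (w - 1).
  have b'1 : b' <= b.+1 - w by exact: geq_minl.
  have b'2 : b' <= w - 1 by exact: geq_minr.
  have b'b : b' <= b by lia.
  apply: explores_weaken (IH b' b'b s q b.+1 w Hc erefl kq _) _ _.
  - have : b'.+1 * l <= b.+1 * l by rewrite leq_mul2r ltnS b'b orbT.
    by lia.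
  - rewrite /walk_cost muln0 mul0n addn0 -[_ * leaves _ _]/(_ * 'C(A + (b.+1 -
    w), b.+1 - w)).
    rewrite -[leqRHS]mulnA leq_mul2l; apply/orP; right.
    have B1 : 'C(A + b', b') <= 'C(A + (b.+1 - w), b.+1 - w).
      rewrite -(bin_sub (leq_addl _ b')) -(bin_sub (leq_addl _ (_ - _))) !addnK.
      by apply: leq_bin2l; rewrite leq_add2l.
    (* Adding the two bounds on [b'] gives [2 * b' <= b]; here the halving of the budget enters. *)
    have B2 : 4 ^ b' <= 2 ^ b by rewrite -[4]/(2 ^ 2) -expnM leq_exp2l //; lia.
    have B3 : sigma ^ b' <= sigma ^ (b.+1 - w) by rewrite leq_pexp2l.
    by apply: leq_trans _ (leq_mul B2 (leq_mul B3 B1)); rewrite /nodes;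
      apply: eq_leq; ring.
  (* With no column left, [hd v t < w] forces [w] to be positive, so the truncated [w - 1] is
     exact. *)
  - move=> [v [gv h1 h2]]; exists v; split=> //; rewrite leq_min.
    by rewrite /= muln0 addn0 in h2; apply/andP; split; lia.
have Ei : items s q m.+1 = arr s 5 q :: items s q.+1 m by [].
set j := arr s 5 q in Ei; set t := arr s 2; set its := items s q.+1 m in Ei.
rewrite Ei /= in Hu; case/andP: Hu => jits Hu.
have jR : j \in R by apply: Hs; rewrite Ei inE eqxx.
have Hs' : {subset its <= R} by move=> x Hx; apply: Hs; rewrite Ei inE Hx orbT.
have Eq : q + m.+1 = q.+1 + m by rewrite addnS.
have bW : b.+1 < W by nia.
apply: explores_weaken (item_explores (X0 := walk_cost b m (b.+1 - w))
  (X1 := walk_cost b m (b.+1 - w.+1)) (P0 := reachable_solution t its b.+1 w)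
  (P1 := fun c => reachable_solution (upd t j c) its b.+1 w.+1)
  Hc _ _ bW _ jR _ _) _ _; try lia.
- move=> s1 c1 k1 t1; rewrite Eq in c1 k1 *.
  have Ei1 : items s1 q.+1 m = its by apply: items_keeps k1 _.
  by have H := IHm q.+1 w s1 c1 wb; rewrite Ei1 t1 in H; apply: H => //; lia.
- move=> c s1 Hc1 Hw c1 k1 t1; rewrite Eq in c1 k1 *.
  rewrite kq addn1 in c1.
  have Ei1 : items s1 q.+1 m = its by apply: items_keeps k1 _.
  by have H := IHm q.+1 w.+1 s1 c1 Hw; rewrite Ei1 t1 in H; apply: H => //; lia.
- have -> : (q < k0) = false by lia.
  rewrite subn0 /walk_cost.
  set Y := node_time * 2 ^ b + 2 * m * item_time.
  have -> : node_time * 2 ^ b + 2 * m.+1 * item_time = Y + 2 * item_time by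
    rewrite /Y; lia.
  have g1 := leaves_gt0 m (b.+1 - w); have g2 := leaves_gt0 m (b.+1 - w.+1).
  have sg r : 0 < sigma ^ r by rewrite expn_gt0 sigma_gt0.
  case: ltnP => Hw; last first.
    have -> : b.+1 - w = 0 by lia.
    by rewrite /= !addn0 expn0 !mul1n; have := leaves_gt0 m 0; nia.
  have -> : b.+1 - w = (b.+1 - w.+1).+1 by lia.
  set r := b.+1 - w.+1 in g2 *; rewrite /= expnS.
  have := leaves_gt0 m r.+1; have := sg r.
  set L1 := leaves m r.+1; set L2 := leaves m r; set E := sigma ^ r => E0 L10.
  have E1 : 0 < sigma * E * L1 by rewrite !muln_gt0 sigma_gt0 E0.
  have E2 : 0 < E * L2 by rewrite muln_gt0 E0.
  have -> : (Y + 2 * item_time) * (sigma * E * (L1 + L2)) =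
     Y * (sigma * E * L1) + 2 * item_time * (sigma * E * L1) +
     sigma * (Y * (E * L2)) + sigma * (2 * item_time * (E * L2)) by ring.
  have : item_time * 2 <= 2 * item_time * (sigma * E * L1) by rewrite mulnC
    leq_pmulr.
  have : sigma * item_time <= sigma * (2 * item_time * (E * L2)).
    by rewrite leq_mul2l -mulnA mulnCA leq_pmulr ?orbT // muln_gt0.
  by lia.
- move=> [v [gv h1 h2]]; rewrite Ei /= -/t in h2.
  (* Writing [v j] lowers the distance and the count by one and raises [w] by one. So distance plus
     [w] is unchanged, and in the strict inequality both sides drop by one. *)
  case: (eqVneq (v j) (t j)) h2 => [vt|vt] /= h2.
    by left; exists v; split=> //; rewrite -/t; lia.
  have jl := R_lt jR; have Hh := hd_upd jl vt.
  have q0 : (q < k0) = false by lia.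
  right; exists (v j); split; first by rewrite q0; exact: (gv.1 j jl).
    by rewrite -/t in h1; lia.
  exists v; rewrite count_upd //; split=> //; rewrite -/t in h1; lia.
Qed.

Lemma solve_explores b : b <= D -> solve_ok b.
Proof.
elim/ltn_ind: b => b IH bD s q b0 w0 Hc Eb kq qW.
have bW : b < W by nia.
have qlW : q + l < W by nia.
(* The list has at most [A + b], hence at most [2 * A], columns. With the bound on [size R] the
   multiples of [n * A] add up to 400 + 800 + 800, the constant of [node_time]. *)
have Ub : 200 * (n + size R).+1 + 4 * A * item_time <= node_time.
  have : A <= n * A by rewrite leq_pmull.
  by rewrite /node_time /item_time mulnS; move: R_le; lia.
have B0 : 0 < 'C(A + b, b) by rewrite bin_gt0 leq_addl.
have N0 : 0 < nodes b by rewrite !muln_gt0 !expn_gt0 B0 sigma_gt0.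
have UN : node_time <= node_time * nodes b by rewrite leq_pmulr.
have := solve_spec Hc qlW; rewrite Eb => /(_ bW) [T [s1 [Hr HT HQ]]].
case: HQ => [[m1 n1 Hg]|[i1 m1 q1 t1 [k1 [i Hin Hi]]]|[f [fn Hf1 Hf2] [c1 t1 k1
  it1]]].
- exists T, s1; split; [done|lia|left; split=> //].
  exists (arr s 2); split=> // j jl.
  by have [[_ _ /(_ _ jl) []]] := Hc.
- exists T, s1; split; [done|lia|right; split=> //; split=> //].
  move=> [v [gv Hh]].
  have := @row_dist_triangle (arr s 2) v i (fun j jl => proj1 (andP (gv.1 j
    jl))).
  by have := gv.2 i Hin; lia.
set L := differing f (arr s 2) in c1 it1 *.
have vs : valid (arr s 2) by have [[]] := Hc.
have sL : size L <= A + b.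
  rewrite size_differing //; have := miss_le fn; have := d_le fn.
  by rewrite /A; lia.
have sLl : size L <= l.
  rewrite /L size_filter; exact: leq_trans (count_size _ _) size_R.
case: b Eb IH bD qW bW B0 N0 UN Hf2 c1 sL => [|b] Eb IH bD qW bW B0 N0 UN Hf2
  c1 sL.
  (* Budget 0 leaves no room between [d f] and [d f + b], so no list is ever scanned. *)
  by lia.
have := walk_explores (b := b) bD _ c1 _ kq _ _ _; rewrite it1 => Hw.
have {}Hw : explores s1 q (q + size L) (arr s1 2) (walk_cost b (size L) b.+1)
    (reachable_solution (arr s1 2) L b.+1 0).
  have := Hw; rewrite subn0; apply=> //.
  - by move=> b' Hb'; apply: IH; lia.
  - by lia.
  - exact: filter_uniq.
  - by move=> x; rewrite mem_filter => /andP [].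
have [T2 [s2 [Hr2 HT2 HQ]]] := Hw; rewrite t1 in HQ.
exists (T + T2), s2; split; first exact: reach_trans Hr Hr2.
  have H1 : walk_cost b (size L) b.+1 <=
     (node_time * 2 ^ b + 4 * A * item_time) * (sigma ^ b.+1 * ('C(A + b.+1,
       b.+1) * 2 ^ b.+1)).
    rewrite /walk_cost -leaves_total leq_mul //.
      by rewrite leq_add2l leq_mul2r; apply/orP; right; rewrite /A in sL *; lia.
    by rewrite leq_mul2l leaves_mono ?orbT.
  (* As 4^(b+1) is 2^(b+1) times (2^b + 2^b), the leaves of the walk take one half; the other pays
     for [solve] and the stack operations. *)
  have H2 : node_time * nodes b.+1 = (node_time * 2 ^ b + node_time * 2 ^ b) * 
      (sigma ^ b.+1 * ('C(A + b.+1, b.+1) * 2 ^ b.+1)).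
    have E : 4 ^ b.+1 = 2 ^ b.+1 * (2 * 2 ^ b) by rewrite -expnS -expnMn.
    rewrite /nodes E; ring.
  rewrite H2; move: H1; set X := sigma ^ b.+1 * _ => H1.
  have X0 : 0 < X by rewrite !muln_gt0 !expn_gt0 B0 sigma_gt0.
  have P0 : 0 < 2 ^ b by rewrite expn_gt0.
  have : 200 * (n + size R).+1 + 4 * A * item_time * X <= node_time * 2 ^ b * X.
    apply: (leq_trans (n := node_time * X)); last by rewrite leq_mul2r
      leq_pmulr ?orbT.
    apply: (leq_trans (n := (200 * (n + size R).+1 + 4 * A * item_time) * X));
      last first.
      by rewrite leq_mul2r Ub orbT.
    by rewrite mulnDl leq_add2r leq_pmulr.
  by rewrite mulnDl in H1 *; lia.
case: HQ => [H|[i2 m2 q2 t2 [k2 nP]]]; [by left|right; split=> //].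
split; first by apply: keeps_trans k1 k2 => //; exact: leq_addr.
move=> [v [gv Hh]]; apply: nP; exists v; split=> //; first by rewrite addn0.
by rewrite add0n; exact: differing_big.
Qed.

(** Each correct guess that changes a letter lowers the distance and the count together, so once all
    are made the distance is at most [d0]. Keeping the letter 1 and the [sigma - 1] siblings give
    exactly [sigma] branches per column. *)
Lemma guess_explores d0 : d0 = d 0 ->
  forall m q s, q + m = k0 -> conf s 1 q k0 (2 * d0 + 2) d0.+1 ->
  k0 + d0.+1 * l < W ->
  uniq (items s q m) -> {subset items s q m <= R} ->
  {in items s q m, forall x, arr s 2 x = 1} ->
  explores s q k0 (arr s 2) ((node_time * nodes d0 + 2 * m * item_time) * sigma
    ^ m)
    (exists v, good v /\
       hd v (arr s 2) <= d0 + count (fun x => v x != arr s 2 x) (items s q m)).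
Proof.
move=> d0E; have d0D : d0 <= D by rewrite d0E d_le.
elim=> [|m IHm] q s Eq Hc qW Hu Hs H1.
  rewrite addn0 in Eq; rewrite Eq in Hc *.
  apply: explores_weaken (solve_explores d0D Hc _ _ qW) _ _ => //.
  - by lia.
  - by rewrite muln0 mul0n addn0 muln1.
  - by move=> [v [gv Hh]]; exists v; rewrite addn0 in Hh.
have Ei : items s q m.+1 = arr s 5 q :: items s q.+1 m by [].
set j := arr s 5 q in Ei; set t := arr s 2; set its := items s q.+1 m in Ei.
rewrite Ei /= in Hu; case/andP: Hu => jits Hu.
have jR : j \in R by apply: Hs; rewrite Ei inE eqxx.
have tj : t j = 1 by apply: H1; rewrite Ei inE eqxx.
have Hs' : {subset its <= R} by move=> x Hx; apply: Hs; rewrite Ei inE Hx orbT.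
have H1' x : x \in its -> t x = 1 by move=> Hx; apply: H1;
  rewrite Ei inE Hx orbT.
have Eq' : q.+1 + m = k0 by lia.
pose P t := exists v, good v /\ hd v t <= d0 + count (fun x => v x != t x) its.
pose X := (node_time * nodes d0 + 2 * m * item_time) * sigma ^ m.
apply: explores_weaken (item_explores (X0 := X) (X1 := X) (P0 := P t)
  (P1 := fun c => P (upd t j c)) Hc _ _ _ _ jR _ _) _ _; try nia.
- move=> s1 c1 k1 t1.
  have Ei1 : items s1 q.+1 m = its by apply: items_keeps k1 _; lia.
  by have H := IHm q.+1 s1 Eq' c1 qW; rewrite Ei1 t1 in H; apply: H.
- move=> c s1 Hc1 Hw c1 k1 t1.
  have Ei1 : items s1 q.+1 m = its by apply: items_keeps k1 _; lia.
  rewrite (_ : k0 <= q = false) ?addn0 in c1; last by lia.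
  have H := IHm q.+1 s1 Eq' c1 qW; rewrite Ei1 t1 in H; apply: H => // x Hx.
  by rewrite /upd; case: (x =P j) Hx => [->|_ /H1' //]; rewrite (negbTE jits).
- have -> : (q < k0) by lia.
  rewrite (_ : d0.+1 < 2 * d0 + 2); last by lia.
  rewrite -/X /= expnS.
  have S0 : 0 < sigma ^ m by rewrite expn_gt0 sigma_gt0.
  have -> : (node_time * nodes d0 + 2 * m.+1 * item_time) * (sigma * sigma ^ m)
    =
     sigma * X + sigma * (2 * item_time * sigma ^ m) by rewrite /X mulnS; ring.
  have : 2 * item_time <= 2 * item_time * sigma ^ m by rewrite leq_pmulr.
  by case: sigma sigma_gt0 => // g _; rewrite subSS subn0; nia.
- move=> [v [gv Hh]]; rewrite Ei /= -/t in Hh.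
  case: (eqVneq (v j) (t j)) Hh => [vt|vt] /= Hh; first by left; exists v.
  have jl := R_lt jR; have E := hd_upd jl vt.
  have := gv.1 j jl => Hv.
  right; exists (v j); split; [|by lia|].
    (* The stored choice is 1 here, and [v j] exceeds it because it is a letter other than
       [t j = 1]. *)
    by rewrite tj in vt; lia.
  by exists v; rewrite count_upd //; split=> //; rewrite -/t in Hh; lia.
Qed.

Lemma search_spec s d0 : d0 = d 0 ->
  conf s 1 0 k0 (2 * d0 + 2) d0.+1 -> k0 + d0.+1 * l < W ->
  uniq (items s 0 k0) -> {subset items s 0 k0 <= R} ->
  {in items s 0 k0, forall x, arr s 2 x = 1} ->
  (forall v, good v ->
    hd v (arr s 2) <= d0 + count (fun x => v x != arr s 2 x) (items s 0 k0)) ->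
  runs W search s (fun t s' =>
    t <= (node_time * nodes d0 + 2 * k0 * item_time) * sigma ^ k0 + 30 /\
    (var s' 0 != 0 <-> exists v, good v)).
Proof.
move=> d0E Hc qW Hu Hs H1 Hg.
have [T [s1 [Hr HT HQ]]] := guess_explores d0E (add0n k0) Hc qW Hu Hs H1.
have stop s2 : var s2 9 = 0 -> exec W search s2 2 s2.
  by move=> H9; exact: (@exec_while_stop W s2 (Var 9) search_step H9).
case: HQ => [[m1 n1 Hv]|[i1 m1 q1 t1 [k1 nP]]].
  exists (T + 2), s1; split; first by apply: Hr; exact: stop.
  by split; [lia|split=> // _; rewrite -lt0n].
have : runs W search_step s1 (fun t s2 => [/\ t <= 20, var s2 9 = 0 & var s2 0
  = 0]).
  apply: runs_if; rewrite /= m1 //= => _.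
  apply: runs_if; rewrite /= q1 //= => _.
  next; apply: runs_assign; first by rewrite /=; lia.
  by apply: runs_assign; [rewrite /=; lia|].
case/reach_step; first by rewrite m1.
move=> t2 [s2 [Hr2 [T2 m2 n2]]]; exists (T + (t2.+2 + 2)), s2; split.
  by apply: Hr; apply: Hr2; exact: stop.
split; first by lia.
rewrite n2; split=> // -[v gv]; case: nP; exists v; split=> //; exact: Hg.
Qed.

End Machine.

(** * From the node bound to the running time of the program *)

Lemma bin_le_exp n m : 'C(n, m) <= 2 ^ n.
Proof.
elim: n m => [|n IHn] [|m] //; first by rewrite bin0 expn_gt0.
by rewrite binS expnS mul2n -addnn leq_add.
Qed.

(** The exponent splits into [2 * D + K] for the binomial coefficient and [2 * D] for the power of
    4. *)
Lemma nodes_bound sigma D K b : 0 < sigma -> b <= D ->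
  nodes sigma D K b <= 2 ^ (4 * D + K) * sigma ^ D.
Proof.
move=> s0 bD; rewrite /nodes.
have B1 : 'C(D + K + b, b) <= 2 ^ (2 * D + K).
  by apply: leq_trans (bin_le_exp _ _) _; rewrite leq_exp2l //; lia.
have B2 : 4 ^ b <= 2 ^ (2 * D) by rewrite -[4]/(2 ^ 2) -expnM leq_exp2l //; lia.
have B3 : sigma ^ b <= sigma ^ D by rewrite leq_pexp2l.
apply: leq_trans (leq_mul (leq_mul B1 B2) B3) _.
by rewrite -expnD leq_mul2r; apply/orP; right; rewrite leq_exp2l //; lia.
Qed.

Section Program.
Variables (W n l sigma D K : nat) (d M : nat -> nat).
Let S i j := M (i * l + j).
Hypothesis W_big : n + sigma + 4 * (D.+1 * l.+1) < W.
Hypothesis d_le : forall i, i < n -> d i <= D.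
Hypothesis S_le : forall i j, i < n -> j < l -> S i j <= sigma.
Hypotheses (n_gt0 : 0 < n) (l_gt0 : 0 < l) (sigma_gt0 : 0 < sigma).
Hypothesis miss_le : forall i, i < n -> row_miss l M i <= K.

Let t0 := start l M.
Let R := mixed_cols n l M l.
Let k0 := size (missing_cols l M l).

Lemma missing_cols_uniq : uniq (missing_cols l M l).
Proof. by apply: filter_uniq; exact: iota_uniq. Qed.

Lemma k0_le : k0 <= K.
Proof.
apply: leq_trans (miss_le n_gt0); rewrite /k0 size_filter /row_miss.
rewrite -(big_mkord xpredT (fun j => nat_of_bool (S 0 j == 0))) /index_iota
  subn0.
by elim: (iota 0 l) => [|x r IHr]; rewrite ?big_nil // big_cons leq_add2l.
Qed.

(** Where row 0 has a letter, [start] copies it, so each difference there is a mismatch of [v] with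
    row 0. *)
Lemma hd_start v : good n l sigma d M v ->
  hd l v t0 <= d 0 + count (fun x => v x != t0 x) (missing_cols l M l).
Proof.
move=> [v_ /(_ 0 n_gt0) Hv]; apply: leq_trans (leq_add Hv (leqnn _)).
rewrite count_filter.
have -> : count (predI (fun x => v x != t0 x) (fun j => S 0 j == 0)) (iota 0 l)
    = \sum_(j < l) ((v j != t0 j) && (S 0 j == 0)).
  rewrite -(big_mkord xpredT (fun j => nat_of_bool ((v j != t0 j) && (S 0 j ==
    0)))).
  rewrite /index_iota subn0.
  by elim: (iota 0 l) => [|x r IHr]; rewrite ?big_nil // big_cons -IHr.
rewrite -big_split; apply: leq_sum => j _ /=.
have := v_ j (ltn_ord j); rewrite /mism /t0 /start -/(S 0 j).
by case: (S 0 j) => [|x] /=; lia.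
Qed.

(** Each mixed column has a row that mismatches [t0] or is missing there. Row [i] accounts for at
    most [d i + d 0 + k0] columns of the first kind and [K] of the second. *)
Lemma mixed_le : (forall i, i < n -> row_dist l M t0 i <= d i + (d 0 + k0)) ->
  size R <= 2 * (n * (D + K)).
Proof.
move=> H; rewrite /R size_filter.
have -> : count (fun j => \sum_(i < n) (S i j != t0 j) != 0) (iota 0 l)
    = \sum_(j < l) (\sum_(i < n) (S i j != t0 j) != 0).
  rewrite -(big_mkord xpredT
    (fun j => nat_of_bool (\sum_(i < n) (S i j != t0 j) != 0))) /index_iota
      subn0.
  by elim: (iota 0 l) => [|x r IHr]; rewrite ?big_nil // big_cons -IHr.
apply: (leq_trans (n := \sum_(j < l) \sum_(i < n) (S i j != t0 j))).
  by apply: leq_sum => j _; case: (\sum_(i < n) _).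
rewrite exchange_big /=.
apply: (leq_trans (n := \sum_(i < n) 2 * (D + K))); last first.
  by rewrite sum_nat_const card_ord; lia.
apply: leq_sum => i _.
apply: (leq_trans (n := row_dist l M t0 i + row_miss l M i)).
  rewrite -big_split; apply: leq_sum => j _ /=.
  have := start_bounds S_le n_gt0 sigma_gt0 (ltn_ord j).
  by rewrite /mism -/(S i j) -/t0; lia.
have := H i (ltn_ord i); have := miss_le (ltn_ord i); have := d_le (ltn_ord i).
by have := d_le n_gt0; have := k0_le; lia.
Qed.

Lemma conrmc_spec s :
  input n l sigma d M s -> (forall x, 2 < x -> var s x = 0) ->
  (forall a x, 1 < a -> arr s a x = 0) ->
  runs W conrmc s (fun t s' =>
    t <= 100 * 100 * (n * l + 2 ^ (4 * D + K) * sigma ^ (D + K) * (n * (D +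
      K))) /\
    (var s' 0 != 0 <-> exists v, good n l sigma d M v)).
Proof.
move=> in0 var0 arr0; have [n_ l_ s_ d_ M_] := in0.
have nl1 : n <= n * l by rewrite leq_pmulr.
have nl2 : l <= n * l by rewrite leq_pmull.
have kl : k0 <= l.
  by rewrite /k0 size_filter (leq_trans (count_size _ _)) ?size_iota.
have dD := d_le n_gt0.
apply: runs_if; rewrite /= ?l_ => H; last by lia.
apply: runs_if; rewrite /= ?s_ => {}H; last by lia.
apply: runs_if; rewrite /= ?n_ => {}H; last by lia.
next; apply: (runs_weaken (initialise_spec W_big S_le n_gt0 sigma_gt0 in0 var0
  arr0)).
move=> t1 s1 [T1 [in1 q1] ds1 st1 [r1 k1 R1 it1]].
rewrite -/k0 in k1 it1; rewrite -/R in r1 R1.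
have [n1 l1 s1_ d1 M1] := in1.
have rd i : row_dist l M (arr s1 2) i = row_dist l M t0 i.
  by apply: eq_bigr => j _; rewrite st1.
have cnt v : count (fun x => v x != arr s1 2 x) (missing_cols l M l) =
             count (fun x => v x != t0 x) (missing_cols l M l).
  apply: eq_in_count => x; rewrite mem_filter mem_iota => /andP [_ /= xl].
  by rewrite st1.
have hd1 v : hd l v (arr s1 2) = hd l v t0.
  by apply: eq_bigr => j _; rewrite st1.
next; apply: runs_assign; first by rewrite /= d1 k1; nia.
rewrite /= d1 k1; set s2 := set_var _ _ _.
have [A1 A2] : input n l sigma d M s2 /\ dist_ok n l M s2 by split.
next; apply: (runs_weaken (find_spec W_big A1 A2 (erefl _))).
move=> t3 s3 [T3 [F3 G3] Hf].
have in3 : input n l sigma d M s3 by split; rewrite ?F3 ?G3.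
have n3 : var s3 0 = n by rewrite F3.
have Tinit : t1 + t3 <= 600 * (n * l) by nia.
apply: runs_if; rewrite /= n3 => Hc; last first.
  have H18 : var s3 18 <> n by move=> E; rewrite E eqxx in Hc.
  apply: runs_assign; first by rewrite /=; lia.
  split; first by rewrite /=; lia.
  (* Rejection is sound: a solution is within [d 0 + k0] of the initial string, so the triangle
     inequality would put the row found within its slack. *)
  split=> //= -[v gv]; case: Hf => [[] //|[fn]]; rewrite /= rd.
  set f := var s3 18 in fn * => Hf.
  have : row_dist l M t0 f <= row_dist l M v f + hd l v t0.
    by apply: row_dist_triangle => j jl; have /andP [] := gv.1 j jl.
  have := hd_start gv; have := gv.2 f fn.
  have := count_size (fun x => v x != t0 x) (missing_cols l M l).
  by rewrite -/k0; lia.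
have {Hc} H18 : var s3 18 = n by case: (var s3 18 =P n) Hc.
have {}Hf i : i < n -> row_dist l M t0 i <= d i + (d 0 + k0).
  case: Hf => [[_ Hf]|[Hf _]]; last by rewrite H18 ltnn in Hf.
  by move=> Hi; rewrite -rd; exact: Hf.
have k3 : var s3 4 = k0 by rewrite F3.
have d3 : arr s3 0 = d by rewrite G3.
next; apply: runs_assign; first by rewrite /= k3; nia.
rewrite /= k3; next; apply: runs_assign; first by rewrite /= d3; nia.
rewrite /= d3 addn1; next; apply: runs_assign; first by rewrite /=; nia.
rewrite /=; next; apply: runs_assign; first by rewrite /=; lia.
rewrite /=; set s4 := set_var _ _ _.
have Rl : {in R, forall j, j < l}.
  by move=> j; rewrite mem_filter mem_iota => /andP [].
have Ru : uniq R by apply: filter_uniq; exact: iota_uniq.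
have off i j : i < n -> j < l -> j \notin R -> M (i * l + j) = t0 j.
  move=> Hi jl; rewrite mem_filter mem_iota add0n leq0n jl !andbT negbK
    sum_nat_eq0.
  move=> /forallP /(_ (Ordinal Hi)) /=; rewrite eqb0 negbK => /eqP -> //.
have a4 a : 1 < a -> arr s4 a = arr s1 a by move=> Ha; rewrite /= G3.
have it4 : items s4 0 k0 = missing_cols l M l by rewrite -[RHS]it1 /items a4.
have c4 : conf n l sigma d M R k0 t0 s4 1 0 k0 (2 * d 0 + 2) (d 0).+1.
  split; last by split; rewrite /= ?F3 //; lia.
  split.
  - by split; rewrite /= ?F3 // => x; rewrite G3 //= R1.
  - by move=> i Hi; rewrite !a4 // ds1.
  - move=> j jl; rewrite a4 // st1 //; split=> //.
    exact: (start_bounds S_le n_gt0 sigma_gt0 jl).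
have qW : k0 + (d 0).+1 * l < W by nia.
have Hs : {subset items s4 0 k0 <= R}.
  rewrite it4 => j; rewrite !mem_filter => /andP [Sj ->]; rewrite andbT.
  rewrite sum_nat_eq0; apply/negP => /forallP /(_ (Ordinal n_gt0)) /=.
  by rewrite eqb0 negbK /start Sj eq_sym (eqP Sj).
apply: (runs_weaken (search_spec (K := K) W_big d_le S_le n_gt0 sigma_gt0 Ru Rl
  off
   miss_le (mixed_le Hf) (erefl _) c4 qW _ Hs _ _)).
- by rewrite it4; exact: missing_cols_uniq.
- rewrite it4 => j; rewrite mem_filter mem_iota => /andP [Sj /= jl].
  by rewrite a4 // st1 // /start Sj.
- by move=> v gv; rewrite it4 a4 // hd1 cnt; exact: hd_start.
move=> t5 s5 [T5 Hgood]; split=> //.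
set X := _ * sigma ^ (D + K).
have kK := k0_le.
have N1 := nodes_bound K sigma_gt0 dD.
have S1 : sigma ^ k0 <= sigma ^ K by rewrite leq_pexp2l.
have V1 : 2 * k0 * item_time n <= node_time n D K.
  have : k0 * n.+1 <= K * (2 * n) by apply: leq_mul => //; lia.
  by rewrite /item_time /node_time; lia.
have N0 : 0 < nodes sigma D K (d 0).
  by rewrite !muln_gt0 !expn_gt0 sigma_gt0 bin_gt0 leq_addl.
have T6 : t5 <= 2 * node_time n D K * X + 30.
  apply: leq_trans T5 _; rewrite leq_add2r.
  apply: (leq_trans (n := (2 * node_time n D K * nodes sigma D K (d 0)) * sigma
    ^ K)).
    apply: leq_mul S1; have : node_time n D K <= node_time n D K * nodes sigma
      D K (d 0).
      by rewrite leq_pmulr.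
    by lia.
  apply: leq_trans (leq_mul (leq_mul (leqnn _) N1) (leqnn _)) _.
  by rewrite /X (expnD sigma); apply: eq_leq; ring.
(* [D + K + 1] is at most [2 * (D + K)] unless [D + K] is zero; then [X] is 1 and the term [n * l]
   pays, as [l] is positive. *)
have T7 : node_time n D K * X <= 2000 * (n * l) + 4000 * (X * (n * (D + K))).
  have [E|N] := eqVneq (D + K) 0.
    have [D0 K0] : D = 0 /\ K = 0 by lia.
    by rewrite /X /node_time D0 K0 !muln0 !expn0 !muln1; lia.
  have H1 : n * (D + K).+1 <= 2 * (n * (D + K)).
    by rewrite mulnS mul2n -addnn leq_add2r leq_pmulr // lt0n.
  rewrite /node_time; have : n * (D + K).+1 * X <= 2 * (n * (D + K)) * X.
    by rewrite leq_mul2r H1 orbT.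
  by lia.
rewrite /= ; lia.
Qed.

End Program.

(** * From matrices over a finite type to arrays of numbers *)

Section Encoding.
Variables (Sigma : finType) (n l : nat).
Variables (S : 'M[option Sigma]_(n, l)) (d : 'I_n -> nat).
Let dd := arr (input_state S d) 0.
Let M := arr (input_state S d) 1.

Lemma input_entry (i : 'I_n) (j : 'I_l) : M (i * l + j) = encode_entry (S i j).
Proof. exact: input_state_entry. Qed.

Lemma delta_row_dist (w : 'rV[Sigma]_l) (v : nat -> nat) (i : 'I_n) :
  (forall j : 'I_l, v j = (enum_rank (w ord0 j)).+1) ->
  delta (map_mx Some w) (row i S) = row_dist l M v i.
Proof.
move=> Hv; rewrite /delta -sum1_card big_mkcond; apply: eq_bigr => j _.
rewrite inE !mxE input_entry Hv /mism; case: (S i j) => [a|] //=.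
rewrite eqSS eq_sym (inj_eq val_inj) (inj_eq enum_rank_inj) andbT.
by rewrite (inj_eq (@Some_inj _)); case: (_ == _).
Qed.

Lemma good_ConRMC :
  (exists v, good n l #|Sigma| dd M v) <-> ConRMC S d.
Proof.
split=> [[v [v_ Hv]]|[w Hw]].
  have pf (j : 'I_l) : (v j).-1 < #|Sigma| by have := v_ j (ltn_ord j); lia.
  exists (\row_(j < l) enum_val (Ordinal (pf j)))%R => i.
  rewrite (@delta_row_dist _ v) => [|j].
    by have := Hv i (ltn_ord i); rewrite /dd input_state_radius.
  rewrite mxE enum_valK /= prednK //; by have := v_ j (ltn_ord j); lia.
pose v j := if insub j is Some o then (enum_rank (w ord0 (o : 'I_l))).+1 else 0.
have vE (j : 'I_l) : v j = (enum_rank (w ord0 j)).+1 by rewrite /v valK.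
exists v; split=> [j jl|i Hi].
  by rewrite -[j]/(val (Ordinal jl)) vE /= ltn_ord.
rewrite -[i]/(val (Ordinal Hi)) -(delta_row_dist _ vE).
by rewrite /dd input_state_radius; exact: Hw.
Qed.

Lemma input_radius_le i : i < n -> dd i <= max_radius d.
Proof.
move=> Hi; rewrite -[i]/(val (Ordinal Hi)) /dd input_state_radius.
exact: leq_bigmax.
Qed.

Lemma input_entry_le i j : i < n -> j < l -> M (i * l + j) <= #|Sigma|.
Proof.
move=> Hi Hj; have := input_entry (Ordinal Hi) (Ordinal Hj); rewrite /= => ->.
by case: (S _ _) => //= a; exact: ltn_ord.
Qed.

Lemma input_miss_le i : i < n -> row_miss l M i <= max_missing S.
Proof.
move=> Hi.
have -> : row_miss l M i = #|[set j : 'I_l | S (Ordinal Hi) j == None]|.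
  rewrite -sum1_card big_mkcond; apply: eq_bigr => j _.
  rewrite inE -[i]/(val (Ordinal Hi)) input_entry.
  by case: (S _ _).
exact: (leq_bigmax (Ordinal Hi)).
Qed.

Lemma input_state_input : input n l #|Sigma| dd M (input_state S d).
Proof. by []. Qed.

(** The order of the tests matters: for [l = 0] the empty string is a solution even over an empty
    alphabet, and an empty alphabet means rejection only afterwards. *)
Lemma conrmc_degenerate W : 1 < W -> [|| l == 0, #|Sigma| == 0 | n == 0] ->
  runs W conrmc (input_state S d)
    (fun t s => t <= 20 /\ (var s 0 != 0 <-> ConRMC S d)).
Proof.
move=> W1 H.
apply: runs_if => /= Hl; last first.
  apply: runs_assign => //=; split=> //; split=> // _; apply/good_ConRMC.
  exists (fun=> 0); split=> [j|i _]; first by rewrite Hl.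
  by rewrite /row_dist big1 // => -[j jl] _; exfalso; move: jl; rewrite Hl.
apply: runs_if => /= Hs; last first.
  apply: runs_assign => /=; first by lia.
  split=> //; split=> // -[w _]; have l0 : 0 < l by rewrite lt0n.
  have := ltn_ord (enum_rank (w ord0 (Ordinal l0))).
  by rewrite {2}Hs.
apply: runs_if => /= Hn; first by rewrite (negbTE Hl) (negbTE Hs) (negbTE Hn)
  in H.
apply: runs_assign => //=; split=> //; split=> // _; apply/good_ConRMC.
by exists (fun=> 1); split=> [j _|i]; [rewrite /= lt0n|rewrite Hn].
Qed.

(** The product is below the square of the magnitude, and since the magnitude is at least 2, two
    more factors of it absorb the 4. *)
Lemma input_magnitude_big :
  n + #|Sigma| + 4 * ((max_radius d).+1 * l.+1) < input_magnitude Sigma l d ^ 4.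
Proof.
set X := input_magnitude _ _ _.
have X2 : 2 <= X by rewrite /X /input_magnitude leq_addl.
have XX : (max_radius d).+1 * l.+1 <= X.-1 * X.-1.
  by apply: leq_mul; rewrite /X /input_magnitude; lia.
have -> : X ^ 4 = X * X * (X * X) by rewrite !expnS; ring.
have : n + #|Sigma| + 2 <= X by rewrite /X /input_magnitude; lia.
have : 4 * (X * X) <= X * X * (X * X) by rewrite leq_mul2r (leq_mul X2 X2) orbT.
have : X.-1 * X.-1 + 2 * X = X * X + 1.
  by case: X X2 {XX} => // x _ /=; ring.
by lia.
Qed.

End Encoding.

Theorem theorem12 :
  exists (p : cmd) (c C : nat),
  forall (Sigma : finType) (n l : nat)
    (S : 'M[option Sigma]_(n, l)) (d : 'I_n -> nat),
  let D := max_radius d in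
  let k := max_missing S in
  exists (t : nat) (s : state),
    [/\ exec (input_magnitude Sigma l d ^ c) p (input_state S d) t s,
        t <= C * maxn 1 (n * l + 2 ^ (4 * D + k) * #|Sigma| ^ (D + k)
                                 * (n * (D + k)))
      & var s 0 != 0 <-> ConRMC S d].
Proof.
exists conrmc, 4, (100 * 100) => Sigma n l S d D k.
have Wb := input_magnitude_big Sigma l d.
case: (boolP [|| l == 0, #|Sigma| == 0 | n == 0]) => [deg|].
  have [|t [s [He [Ht Hs]]]] := conrmc_degenerate (W :=
    input_magnitude Sigma l d ^ 4) S d _ deg.
    by lia.
  exists t, s; split=> //.
  (* For degenerate sizes the formula may vanish; the [maxn 1] absorbs the constant time. *)
  by apply: leq_trans Ht _; rewrite (leq_trans _ (leq_mul (leqnn _) (leq_maxl _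
    _))).
rewrite !negb_or -!lt0n => /and3P [l0 s0 n0].
have [|x|t [s [He [Ht Hs]]]] := conrmc_spec Wb (@input_radius_le _ _ _ S d)
  (@input_entry_le _ _ _ S d) n0 l0 s0 (@input_miss_le _ _ _ S d)
  (input_state_input S d).
- by move=> [|[|[|x]]] //= _; rewrite nth_nil.
- by move=> y; case: x => [|[|x]] //= _; rewrite !nth_nil.
exists t, s; split=> //.
  by apply: leq_trans Ht _; rewrite leq_mul2l leq_maxr orbT.
by rewrite Hs; exact: good_ConRMC.
Qed.
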